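(* Let $\mathbf{x}$ be an $n$-periodic trajectory of a discrete Lagrangian system on an $m$-dimensional manifold with Poincaré map $P:W\to W$. Suppose that $V=\operatorname{Ker}(P-I)$ is isotropic, $\dim V=k$, that the generalized eigenspace $N=\operatorname{Ker}(P-I)^{2m}$ has dimension $2k$, and that $\mathbf{x}$ is nondegenerate $\mathrm{mod}\ V$, that is, the matrices $G_i$ (for all $i$), $\overline G$ and $A^\perp$ are nondegenerate. Then $$\sigma(-1)^{\operatorname{ind} h}=\sigma^\perp(-1)^{\operatorname{ind} h^\perp+\operatorname{ind} b}.$$
   Context: Summation over repeated Greek indices from $1$ to $k$ is assumed; $\operatorname{ind}$ is the negative index (maximal dimension of a negative definite subspace) of a symmetric bilinear form. For a discrete Lagrangian $L$ on $M\times M$ and an $n$-periodic trajectory $\mathbf{x}=(x_i)$ (i.e. $x_{i+n}=x_i$ and $\partial_2L(x_{i-1},x_i)+\partial_1L(x_i,x_{i+1})=0$), put $E_i=T_{x_i}M$, $A_i=\partial_{22}L(x_{i-1},x_i)+\partial_{11}L(x_i,x_{i+1}):E_i\to E_i^*$ (symmetric), $B_i=-\partial_1\partial_2L(x_i,x_{i+1}):E_i\to E_{i+1}^*$, assumed nondegenerate. Trajectories of the variational system are sequences $u_i\in E_i$, $i\in\mathbb{Z}$, with $A_iu_i-B_{i-1}u_{i-1}-B_i^*u_{i+1}=0$; $W$ is the space of them (identified with pairs $(u_0,u_1)$), $P:(u_0,u_1)\mapsto(u_n,u_{n+1})$, and $\omega(\mathbf{u},\mathbf{v})=\langle B_ju_j,v_{j+1}\rangle-\langle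 B_jv_j,u_{j+1}\rangle$ (independent of $j$) is the $P$-invariant symplectic form. $X=E_1\times\dots\times E_n$ is identified with $n$-periodic sequences, and $h(\mathbf{u},\mathbf{v})=\sum_{i=1}^n\langle A_iu_i-B_{i-1}u_{i-1}-B_i^*u_{i+1},v_i\rangle$ is the Hessian of the action on $X$. $\sigma=\operatorname{sign}\prod_{i=1}^n\det B_i$ (bases chosen in $E_1,\dots,E_n$; independent of the choice). Let $w^1,\dots,w^k$ be a basis of $V$, $\mathbf{w}^\alpha=(w_i^\alpha)$ the corresponding $n$-periodic trajectories, $G_i=(g_i^{\alpha\beta})$, $g_i^{\alpha\beta}=\langle B_iw_i^\alpha,w_{i+1}^\beta\rangle$ (symmetric), $(g_{\alpha\beta i})=G_i^{-1}$, $\overline G=\sum_{i=1}^nG_i^{-1}=(\bar g_{\alpha\beta})$. Let $E_i^\perp=\{u\in E_i:\langle B_{i-1}w_{i-1}^\alpha,u\rangle=0,\ \alpha=1,\dots,k\}$, $X^\perp=E_1^\perp\times\dots\times E_n^\perp\subset X$, and $$h^\perp(\mathbf{v},\mathbf{v})=h(\mathbf{v},\mathbf{v})-\sum_{i=1}^ng_{\alpha\beta i}\langle B_iv_i,w_{i+1}^\alpha\rangle\langle B_iv_i,w_{i+1}^\beta\rangle,\qquad \mathbf{v}\in X^\perp .$$ $B_i^\perp:E_i^\perp\to(E_{i+1}^\perp)^*$ is $B_i|_{E_i^\perp}$ followed by restriction of functionals to $E_{i+1}^\perp$, and $\sigma^\perp=\operatorname{sign}\prod_{i=1}^n\det B_i^\perp$.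 Under the hypotheses $N=\operatorname{Ker}(P-I)^2$ is symplectic and $V$ is Lagrangian in $N$; $b(v,w)=\omega((P-I)v,w)$ is a symmetric bilinear form on $N$. Let $q_1,\dots,q_k$ be the basis in a Lagrangian complement of $V$ in $N$ with $\omega(w^\alpha,q_\beta)=\delta^\alpha_\beta$, $\omega(q_\alpha,q_\beta)=0$; then $s_{\alpha\beta}=b(q_\alpha,q_\beta)$ and $A^\perp=(s_{\alpha\beta}-\bar g_{\alpha\beta})$. *)

(* Defs.v *)
From HB Require Import structures.
From mathcomp Require Import all_boot all_order all_algebra.
From mathcomp Require Import all_classical all_reals all_analysis.
Set Implicit Arguments.
Unset Strict Implicit.
Unset Printing Implicit Defensive.
Import Order.TTheory GRing.Theory Num.Theory numFieldNormedType.Exports.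
Local Open Scope classical_set_scope.
Local Open Scope ring_scope.

(* Vectors are rows. A linear map E -> F^* is given by a matrix B through
   <B u, v> = u *m B *m v^T, so that B^* is the transposed matrix. *)

(** * Manifolds and discrete Lagrangians *)

(* For an open subset U of a finite-dimensional space V this is C^2 regularity:
   f and all its directional derivatives of order one and two exist and are
   continuous on U. *)
Definition C2_on (R : realType) (V W : normedModType R) (U : set V)
    (f : V -> W) : Prop :=
  forall x, U x ->
    {for x, continuous f} /\
    forall u, derivable f x u /\ {for x, continuous ('D_u f)} /\
    forall v, derivable ('D_u f) x v /\ {for x, continuous ('D_v ('D_u f))}.

Section Manifold.
Variables (R : realType) (m : nat).

(* The values of cmap outside cdom and of cinv outside the image are junk. *)
Record chart (M : topologicalType) := Chart {
  cdom : set M;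
  cmap : M -> 'rV[R]_m;
  cinv : 'rV[R]_m -> M;
  cdom_open : open cdom;
  cimg_open : open (cmap @` cdom);
  cmapK : forall x, cdom x -> cinv (cmap x) = x;
  cmap_cont : {within cdom, continuous cmap};
  cinv_cont : {within cmap @` cdom, continuous cinv} }.

Record manifold := Manifold {
  mspace :> topologicalType;
  atlas : set (chart mspace);
  mspace_hausdorff : hausdorff_space mspace;
  mspace_countable : @second_countable mspace;
  atlas_cover : forall x, exists2 c, atlas c & cdom c x;
  atlas_compat : forall c c', atlas c -> atlas c' ->
    C2_on (cmap c @` (cdom c `&` cdom c')) (cmap c' \o cinv c) }.

Variable M : manifold.

Definition in_charts (L : M -> M -> R) (c c' : chart M)
    (p : 'rV[R]_m * 'rV[R]_m) : R :=
  L (cinv c p.1) (cinv c' p.2).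

Definition discrete_lagrangian (L : M -> M -> R) : Prop :=
  forall c c', atlas c -> atlas c' ->
    C2_on ((cmap c @` cdom c) `*` (cmap c' @` cdom c')) (in_charts L c c').

Definition D1 (u : 'rV[R]_m) (f : 'rV[R]_m * 'rV[R]_m -> R) :
    'rV[R]_m * 'rV[R]_m -> R := 'D_((u, 0)) f.

Definition D2 (u : 'rV[R]_m) (f : 'rV[R]_m * 'rV[R]_m -> R) :
    'rV[R]_m * 'rV[R]_m -> R := 'D_((0, u)) f.

(* d_2 L(x_{i-1}, x_i) + d_1 L(x_i, x_{i+1}) = 0 in the cotangent space at x_i *)
Definition trajectory (L : M -> M -> R) (x : int -> M) : Prop :=
  forall (i : int) (c c' c'' : chart M),
    atlas c -> atlas c' -> atlas c'' ->
    cdom c (x (i - 1)) -> cdom c' (x i) -> cdom c'' (x (i + 1)) ->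
    forall u : 'rV[R]_m,
      D2 u (in_charts L c c') (cmap c (x (i - 1)), cmap c' (x i))
      + D1 u (in_charts L c' c'') (cmap c' (x i), cmap c'' (x (i + 1))) = 0.

(* A choice, with the period of x, of a chart of the atlas around each x_i; it
   identifies E_i = T_{x_i}M with R^m. *)
Definition charts_along (n : nat) (x : int -> M) (c : int -> chart M) : Prop :=
  forall i, [/\ atlas (c i), cdom (c i) (x i) & c (i + n%:Z) = c i].

Variables (L : M -> M -> R) (x : int -> M) (c : int -> chart M).

Let F i := in_charts L (c i) (c (i + 1)).
Let pt i := (cmap (c i) (x i), cmap (c (i + 1)) (x (i + 1))).
Let e_ (j : 'I_m) : 'rV[R]_m := delta_mx 0 j.

Definition hessA (i : int) : 'M[R]_m :=
  \matrix_(j, l) (D2 (e_ j) (D2 (e_ l) (F (i - 1))) (pt (i - 1))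
                  + D1 (e_ j) (D1 (e_ l) (F i)) (pt i)).

Definition hessB (i : int) : 'M[R]_m :=
  \matrix_(j, l) - D1 (e_ j) (D2 (e_ l) (F i)) (pt i).

End Manifold.

(** * Negative index *)

Definition neg_def_on (R : realType) (vT : vectType R) (f : vT -> vT -> R)
    (D : {vspace vT}) : Prop :=
  forall v, v \in D -> v != 0 -> f v v < 0.

(* negative index of the bilinear form f on the subspace U *)
Definition ind (R : realType) (vT : vectType R) (U : set vT)
    (f : vT -> vT -> R) : nat :=
  \max_(d < (\dim {: vT}).+1 |
        `[< exists D : {vspace vT},
              [/\ \dim D = d, (forall v, v \in D -> U v) & neg_def_on f D] >]) d.

(** * The variational system *)

Section VariationalSystem.
Variables (R : realType) (m n k : nat).
Variables (A B : int -> 'M[R]_m).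

Definition pairing (C : 'M[R]_m) (u v : 'rV[R]_m) : R := (u *m C *m v^T) 0 0.

Definition variation (u : int -> 'rV[R]_m) (i : int) : 'rV[R]_m :=
  u i *m A i - u (i - 1) *m B (i - 1) - u (i + 1) *m (B i)^T.

Definition var_trajectory (u : int -> 'rV[R]_m) : Prop :=
  forall i, variation u i = 0.

Definition init (u : int -> 'rV[R]_m) : 'rV[R]_(m + m) := row_mx (u 0) (u 1).

(* (u_{i-1}, u_i) |-> (u_i, u_{i+1}) *)
Definition step (i : int) : 'M[R]_(m + m) :=
  block_mx 0 (- (B (i - 1) *m invmx (B i)^T)) 1%:M (A i *m invmx (B i)^T).

(* The map (u_0, u_1) |-> (u_n, u_{n+1}) of W, see poincareP below; matrices
   act on the right, so the first factor is applied first. *)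
Definition poincare : 'M[R]_(m + m) := \prod_(1 <= i < n.+1) step i%:Z.

(* W is identified with pairs (u_0, u_1), hence j = 0 in the formula for omega *)
Definition omega (p q : 'rV[R]_(m + m)) : R :=
  pairing (B 0) (lsubmx p) (rsubmx q) - pairing (B 0) (lsubmx q) (rsubmx p).

Definition kerV : 'M[R]_(m + m) := kermx (poincare - 1).

Definition kerN : 'M[R]_(m + m) := kermx ((poincare - 1) ^+ (2 * m)).

Definition bform (p q : 'rV[R]_(m + m)) : R := omega (p *m (poincare - 1)) q.

(* X = E_1 x ... x E_n is represented by 'M_(n, m): the row of index i mod n is
   the component in E_i, so that the component in E_n is the row 0. *)
Definition per (u : 'M[R]_(n, m)) (i : int) : 'rV[R]_m :=
  if insub `|(i %% n%:Z)%Z|%N is Some j then row j u else 0.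

Definition hform (u v : 'M[R]_(n, m)) : R :=
  \sum_(1 <= i < n.+1) (variation (per u) i%:Z *m (per v i%:Z)^T) 0 0.

Definition sigma : R := Num.sg (\prod_(1 <= i < n.+1) \det (B i%:Z)).

Variable w : 'I_k -> int -> 'rV[R]_m.

Definition Gmx (i : int) : 'M[R]_k :=
  \matrix_(a, b) pairing (B i) (w a i) (w b (i + 1)).

Definition Gbar : 'M[R]_k := \sum_(1 <= i < n.+1) invmx (Gmx i%:Z).

(* the row space of Eperp i is E_i^perp *)
Definition Eperp (i : int) : 'M[R]_m :=
  kermx (\matrix_(a < k) (w a (i - 1) *m B (i - 1)))^T.

Definition Xperp : set 'M[R]_(n, m) :=
  [set u | forall i, (per u i <= Eperp i)%MS].

Definition hperp (u v : 'M[R]_(n, m)) : R :=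
  hform u v - \sum_(1 <= i < n.+1) \sum_(a < k) \sum_(b < k)
    invmx (Gmx i%:Z) a b
    * pairing (B i%:Z) (per u i%:Z) (w a (i%:Z + 1))
    * pairing (B i%:Z) (per v i%:Z) (w b (i%:Z + 1)).

(* The rows of e i are a basis of E_i^perp, chosen n-periodically. *)
Definition perp_bases (d : nat) (e : int -> 'M[R]_(d, m)) : Prop :=
  forall i, [/\ row_free (e i), (e i == Eperp i)%MS & e (i + n%:Z) = e i].

Definition Bperp (d : nat) (e : int -> 'M[R]_(d, m)) (i : int) : 'M[R]_d :=
  e i *m B i *m (e (i + 1))^T.

Definition sigma_perp (d : nat) (e : int -> 'M[R]_(d, m)) : R :=
  Num.sg (\prod_(1 <= i < n.+1) \det (Bperp e i%:Z)).

(* The trajectories w^a are n-periodic and their initial data are a basis of V. *)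
Definition basis_of_V : Prop :=
  [/\ forall a, var_trajectory (w a),
      forall a i, w a (i + n%:Z) = w a i,
      row_free (\matrix_(a < k) init (w a))
    & (\matrix_(a < k) init (w a) == kerV)%MS].

(* q is a basis of a Lagrangian complement of V in N, dual to w *)
Definition dual_basis (q : 'I_k -> 'rV[R]_(m + m)) : Prop :=
  [/\ forall a, (q a <= kerN)%MS,
      forall a b, omega (init (w a)) (q b) = (a == b)%:R
    & forall a b, omega (q a) (q b) = 0].

Definition Aperp (q : 'I_k -> 'rV[R]_(m + m)) : 'M[R]_k :=
  (\matrix_(a, b) bform (q a) (q b)) - Gbar.

End VariationalSystem.

Lemma poincareP (R : realType) (m n : nat) (A B : int -> 'M[R]_m)
    (u : int -> 'rV[R]_m) :
  (forall i, B i \in unitmx) -> var_trajectory A B u ->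
  init u *m poincare n A B = row_mx (u n%:Z) (u (n%:Z + 1)).
Proof.
move=> uB tu; rewrite /poincare; elim: n => [|n IHn].
  by rewrite big_nil add0r mulmx1.
rewrite big_nat_recr //= mulmxA IHn /step.
rewrite mul_row_block mulmx0 add0r mulmx1.
have := tu n.+1%:Z; rewrite /variation.
have -> : n.+1%:Z - 1 = n%:Z by rewrite -addn1 PoszD addrK.
have -> : n%:Z + 1 = n.+1%:Z by rewrite -PoszD addn1.
move/eqP; rewrite subr_eq0 => /eqP tun; congr row_mx.
rewrite mulmxN !mulmxA addrC -mulmxBl tun mulmxK //.
by rewrite unitmx_tr.
Qed.

Lemma perP (R : realType) (m n : nat) (s : int -> 'rV[R]_m) :
  (0 < n)%N -> (forall i, s (i + n%:Z) = s i) ->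
  per (\matrix_(j < n) s (j : nat)%:Z) = s.
Proof.
move=> n0 ps; apply/funext => i.
have n0' : n%:Z != 0 by rewrite -lt0n.
have psM (a : nat) j : s (j + n%:Z * a%:Z) = s j.
  elim: a j => [|a IHa] j; first by rewrite mulr0 addr0.
  by rewrite intS mulrDr mulr1 addrA IHa ps.
have psZ (z j : int) : s (j + z * n%:Z) = s j.
  case: z => a; first by rewrite mulrC psM.
  by rewrite NegzE mulNr -(psM a.+1 (j - _)) [n%:Z * _]mulrC subrK.
rewrite /per; case: insubP => [j _ jE|].
  by rewrite rowK jE gez0_abs ?modz_ge0 // [in RHS](divz_eq i n%:Z) addrC psZ.
by rewrite -ltz_nat gez0_abs ?modz_ge0 // ltz_pmod.
Qed.

(* Main.v *)
Require Import Defs.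
From HB Require Import structures.
From mathcomp Require Import all_boot all_order all_algebra ring.
From mathcomp Require Import all_classical all_reals all_analysis.
Import Order.TTheory GRing.Theory Num.Theory numFieldNormedType.Exports.
Local Open Scope classical_set_scope.
Local Open Scope ring_scope.

(** Write W_i for the k x m matrix whose rows are the w_i^a, so that
    G_i = W_i B_i W_{i+1}^T, and beta_i(v) = v_i B_i W_{i+1}^T for a periodic
    sequence v. Since G_{i-1} is nondegenerate, E_i is the direct sum of
    E_i^perp and the row space of W_i.

    The proof compares two orthogonal splittings of one quadratic form. On the
    space Z of pairs (v, d) with v in X^perp and d a periodic sequence in R^k, put
      Q(v, d) = h(v, v) - 2 sum_i <d_i, beta_i(v)> + sum_i d_i G_i d_i^T
    (zform). Because the rows of W are trajectories, h(v + cW, v + cW) =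
    Q(v, d) with d_i = c_{i+1} - c_i, and the pairs arising in this way are
    exactly those with sum_i d_i = 0. So ind h is the index of Q on the
    subspace K = {sum_i d_i = 0} (ind_hform).

    First splitting. Completing the square gives
      Q(v, d) = h^perp(v, v) + sum_i (d_i - beta_i G_i^-1) G_i (d_i - beta_i G_i^-1)^T,
    so ind Q = ind h^perp + sum_i ind G_i (ind_Zflag).

    Second splitting. The trajectory u^b with initial data q_b satisfies
    u_{i+n} = u_i + sum_a s_ba w_i^a, because (P - I) q_b lies in V
    (Qm_moved). Writing u^b = v^b + c^b W, the sequences v^b and
    d^b_i = c^b_{i+1} - c^b_i are periodic, and the equations of the trajectory
    together with the conservation of omega say that the Q-product of
    (v^b, d^b) with (v, d) is the b-th coordinate of sum_i d_i
    (zform_mx_trajectory). Hence these k vectors are Q-orthogonal to K, their Gram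
    matrix is s, and as s is nondegenerate Z = K + span(v^b, d^b). Since the
    form b factors through N / V, where its matrix is s,
    ind Q = ind h + ind b.

    Altogether ind h^perp + sum_i ind G_i = ind h + ind b (index_identity). The
    statement follows from (-1)^(ind G_i) = sign det G_i (sg_det_ind) and
    sigma = sigma^perp prod_i sign det G_i (sigma_split); the latter holds since in
    a basis of each E_i adapted to the splitting B_i is block triangular, with
    diagonal blocks B_i^perp and G_i. The Hessian is symmetric by Schwarz's
    theorem (schwarz), proved here for the regularity class C2_on. *)

Set Implicit Arguments.
Unset Strict Implicit.
Unset Printing Implicit Defensive.

(** * Negative index of a symmetric bilinear form *)

(** Linear subspaces given as sets, the form in which ind takes its domain. *)
Definition is_subspace (R : realType) (vT : vectType R) (U : set vT) : Prop :=
  U 0 /\ forall (a : R) u v, U u -> U v -> U (a *: u + v).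

(** Symmetric bilinear forms; linearity in the second argument follows. *)
Definition sym_bilinear (R : realType) (vT : vectType R) (f : vT -> vT -> R) :
    Prop :=
  (forall (a : R) u v w, f (a *: u + v) w = a * f u w + f v w) /\
  (forall u v, f u v = f v u).

Section Bilinear.
Variables (R : realType) (vT : vectType R) (f : vT -> vT -> R).
Hypothesis fB : sym_bilinear f.

Lemma sbC u v : f u v = f v u. Proof. exact: fB.2. Qed.
Lemma sbDl u v w : f (u + v) w = f u w + f v w.
Proof. by have := fB.1 1 u v w; rewrite scale1r mul1r. Qed.
Lemma sb0l w : f 0 w = 0.
Proof.
have := sbDl 0 0 w; rewrite addr0 => /eqP.
by rewrite -subr_eq0 opprD addNKr oppr_eq0 => /eqP.
Qed.
Lemma sbZl a u w : f (a *: u) w = a * f u w.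
Proof. by have := fB.1 a u 0 w; rewrite !addr0 sb0l addr0. Qed.
Lemma sbDr u v w : f w (u + v) = f w u + f w v.
Proof. by rewrite !(sbC w) sbDl. Qed.
Lemma sb0r w : f w 0 = 0. Proof. by rewrite sbC sb0l. Qed.
Lemma sbZr a u w : f w (a *: u) = a * f w u.
Proof. by rewrite !(sbC w) sbZl. Qed.

Lemma sb_sqrD u v : f u v = 0 -> f (u + v) (u + v) = f u u + f v v.
Proof. by move=> uv; rewrite sbDl !sbDr (sbC v u) uv addr0 add0r. Qed.

End Bilinear.

Section Index.
Variables (R : realType).
Implicit Types (vT : vectType R).

Lemma ind_ge vT (U : set vT) (f : vT -> vT -> R) (D : {vspace vT}) :
  (forall v, v \in D -> U v) -> neg_def_on f D -> (\dim D <= ind U f)%N.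
Proof.
move=> DU nD.
have dD : (\dim D < (\dim {: vT}).+1)%N by rewrite ltnS dimvS ?subvf.
apply: (@leq_bigmax_cond _ _ (fun d : 'I_(\dim {: vT}).+1 => d : nat) (Ordinal dD)).
by apply/asboolP; exists D.
Qed.

Lemma ind_witness vT (U : set vT) (f : vT -> vT -> R) : U 0 ->
  exists D : {vspace vT},
    [/\ \dim D = ind U f, forall v, v \in D -> U v & neg_def_on f D].
Proof.
move=> U0; rewrite /ind.
have [|i /asboolP Pi ->] := eq_bigmax_cond (A := fun d : 'I_(\dim {: vT}).+1 =>
   `[< exists D : {vspace vT},
              [/\ \dim D = d, (forall v, v \in D -> U v) & neg_def_on f D] >])
   (fun d => d : nat).
  apply/card_gt0P; exists ord0; apply/asboolP; exists 0%VS.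
  split; first by rewrite dimv0.
    by move=> v; rewrite memv0 => /eqP ->.
  by move=> v; rewrite memv0 => /eqP ->; rewrite eqxx.
by [].
Qed.

Lemma subspaceB vT (U : set vT) (u v : vT) : is_subspace U -> U u -> U v -> U (u - v).
Proof. by move=> sU uU vU; rewrite addrC -scaleN1r; apply: sU.2. Qed.

Lemma subspace_span vT (U : set vT) (X : seq vT) : is_subspace U ->
  (forall v, v \in X -> U v) -> forall v, v \in <<X>>%VS -> U v.
Proof.
move=> sU; elim: X => [|x X IH] XU v.
  by rewrite span_nil memv0 => /eqP ->; apply: sU.1.
rewrite span_cons => /memv_addP[a /vlineP[t ->] [b bX ->]].
apply: sU.2; first by apply: XU; rewrite mem_head.
by apply: IH bX => y yX; apply: XU; rewrite inE yX orbT.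
Qed.

(** The witness is a subspace of maximal dimension contained in U, obtained as
    the index of the constant form -1, for which every subspace is negative
    definite. *)
Lemma subspace_vspace vT (U : set vT) : is_subspace U ->
  exists D : {vspace vT}, forall v, U v <-> v \in D.
Proof.
move=> sU; pose f (u v : vT) : R := -1.
have [D [dD DU _]] := ind_witness f sU.1.
exists D => v; split=> [Uv|/DU//].
have sub : forall u, u \in (D + <[v]>)%VS -> U u.
  move=> u /memv_addP[a aD [b /vlineP[t ->] ->]].
  by rewrite addrC; apply: sU.2 => //; apply: DU.
have := ind_ge sub (f := f); rewrite -dD => /(_ _)/wrap[].
  by move=> ? _ _; rewrite /f ltrN10.
move=> le; have le2 : (D <= D + <[v]>)%VS by apply: addvSl.
have := dimv_leqif_eq le2; rewrite /leqif => -[le3 eq3].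
have /eqP eqD: D == (D + <[v]>)%VS by rewrite -eq3 eqn_leq le le3.
by rewrite eqD; apply: (subvP (addvSr D <[v]>)); apply: memv_line.
Qed.

(** A splitting of U into a negative definite and a nonnegative part computes
    the index: a negative definite subspace meets the nonnegative part
    trivially. *)
Lemma ind_eq vT (U U1 : set vT) (f : vT -> vT -> R) (D : {vspace vT}) :
  is_subspace U1 -> (forall v, v \in D -> U v) -> neg_def_on f D ->
  (forall v, U1 v -> 0 <= f v v) ->
  (forall u, U u -> exists2 d, d \in D & U1 (u - d)) ->
  ind U f = \dim D.
Proof.
move=> sU1 DU nD pU1 dec; apply/eqP; rewrite eqn_leq ind_ge // andbT.
have U0 : U 0 by apply: DU; rewrite mem0v.
have [D' [<- D'U nD']] := ind_witness f U0.
have [D1 hD1] := subspace_vspace sU1.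
have cap0 : (D' :&: D1 = 0)%VS.
  apply/eqP; rewrite -subv0; apply/subvP => v /memv_capP[v1 /hD1 v2].
  rewrite memv0; apply: contraT => v0.
  by have := nD' v v1 v0; rewrite ltNge pU1.
have sub : (D' + D1 <= D + D1)%VS.
  rewrite subv_add addvSr andbT; apply/subvP => v /D'U/dec[d dD /hD1 dU].
  by rewrite -[v](subrK d) addrC memv_add.
have := dimvS sub; rewrite dimv_disjoint_sum // => h.
have := leq_trans h (dimv_add_leqif D D1).1.
by rewrite leq_add2r.
Qed.

(** The f-orthogonal complement of D in U. *)
Definition orth_in vT (f : vT -> vT -> R) (D : {vspace vT}) (U : set vT) : set vT :=
  [set u | U u /\ forall d, d \in D -> f d u = 0].

Lemma is_subspace_orth_in vT (f : vT -> vT -> R) (D : {vspace vT}) (U : set vT) :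
  sym_bilinear f -> is_subspace U -> is_subspace (orth_in f D U).
Proof.
move=> fB sU; split; first by split; [apply: sU.1 | move=> d _; rewrite (sb0r fB)].
move=> a u v [Uu fu] [Uv fv]; split; first exact: sU.2.
by move=> d dD; rewrite (sbDr fB) // (sbZr fB) // fu // fv // mulr0 addr0.
Qed.

(** A negative definite form is nondegenerate on D, so D has an orthogonal
    projection. *)
Lemma orth_proj vT (f : vT -> vT -> R) (D : {vspace vT}) (u : vT) :
  sym_bilinear f -> neg_def_on f D ->
  exists2 d, d \in D & forall d', d' \in D -> f d' (u - d) = 0.
Proof.
move=> fB nD.
pose r := \dim D.
(* The products with a basis of D; T0 is injective on D, hence onto 'rV_r. *)
pose T0 (x : vT) : 'rV[R]_r := \row_j f (vbasis D)`_j x.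
have T0L : linear T0.
  by move=> a x y; apply/rowP => j; rewrite !mxE (sbDr fB) // (sbZr fB).
pose T1 : {linear vT -> 'rV[R]_r} := HB.pack T0 (GRing.isLinear.Build _ _ _ _ T0 T0L).
have TE x : linfun T1 x = T0 x by rewrite lfunE.
have T0P x : T0 x = 0 -> forall d, d \in D -> f d x = 0.
  move=> Tx d dD; rewrite (coord_vbasis dD).
  elim/big_rec: _ => [|i y _ IH]; first by rewrite (sb0l fB).
  rewrite (sbDl fB) // (sbZl fB) // IH addr0.
  by move/rowP: Tx => /(_ i); rewrite !mxE => ->; rewrite mulr0.
have inj : (D :&: lker (linfun T1) = 0)%VS.
  apply/eqP; rewrite -subv0; apply/subvP => v /memv_capP[vD].
  rewrite memv_ker TE memv0 => /eqP Tv; apply: contraT => v0.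
  by have := nD v vD v0; rewrite (T0P _ Tv) // ltxx.
have dimT := limg_dim_eq inj.
have full : (linfun T1 @: D)%VS = fullv.
  apply/eqP; have := (dimv_leqif_eq (subvf (linfun T1 @: D))).2 => <-.
  by rewrite dimT dimvf /dim /= mul1n.
have : T0 u \in (linfun T1 @: D)%VS by rewrite full memvf.
case/memv_imgP => d dD; rewrite TE => Tu.
exists d => // d' d'D; apply: T0P => //.
have -> : T0 (u - d) = T1 (u - d) by [].
by rewrite linearB /= Tu subrr.
Qed.

(** A negative definite subspace of maximal dimension has a nonnegative
    orthogonal complement. *)
Lemma ind_split vT (U : set vT) (f : vT -> vT -> R) :
  sym_bilinear f -> is_subspace U ->
  exists D : {vspace vT},
    [/\ \dim D = ind U f, forall v, v \in D -> U v, neg_def_on f D,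
        forall v, orth_in f D U v -> 0 <= f v v
      & forall u, U u -> exists2 d, d \in D & orth_in f D U (u - d)].
Proof.
move=> fB sU; have [D [dD DU nD]] := ind_witness f sU.1.
exists D; split=> // [v [Uv ov]|u Uu]; last first.
  have [d dD' hd] := orth_proj u fB nD.
  by exists d => //; split=> //; apply: subspaceB => //; apply: DU.
rewrite leNgt; apply/negP => fv.
have v0 : v != 0 by apply: contraTneq fv => ->; rewrite (sb0l fB) // ltxx.
have sub : forall u, u \in (D + <[v]>)%VS -> U u.
  move=> u /memv_addP[a aD [b /vlineP[t ->] ->]].
  by rewrite addrC; apply: sU.2 => //; apply: DU.
have nDv : neg_def_on f (D + <[v]>)%VS.
  move=> u /memv_addP[a aD [b /vlineP[t ->] ->]].
  have [->|a0] := eqVneq a 0.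
    rewrite add0r => tv0; rewrite (sbZl fB) // (sbZr fB) // mulrA -expr2 pmulr_rlt0 //.
    by rewrite exprn_even_gt0 //=; apply: contraNneq tv0 => ->; rewrite scale0r.
  have o0 : f a (t *: v) = 0 by rewrite (sbZr fB) // ov // mulr0.
  move=> _; rewrite (sb_sqrD fB) // (sbZl fB) // (sbZr fB) // mulrA -expr2.
  by rewrite ltr_wnDr ?nD // mulr_ge0_le0 ?sqr_ge0 // ltW.
have := ind_ge sub nDv.
rewrite -dD leqNgt dimv_disjoint_sum ?dim_vline ?v0 ?addn1 ?leqnn //.
apply/eqP; rewrite -subv0; apply/subvP => u /memv_capP[uD /vlineP[t uE]].
have := ov u uD; rewrite {1}uE (sbZl fB) // => /eqP; rewrite mulf_eq0 (lt_eqF fv) orbF.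
by move/eqP=> t0; rewrite memv0 uE t0 scale0r.
Qed.

(** Additivity of the index; the two summands may intersect in isotropic vectors. *)
Lemma ind_orth_sum vT (U U1 U2 : set vT) (f : vT -> vT -> R) :
  sym_bilinear f -> is_subspace U1 -> is_subspace U2 ->
  (forall u1 u2, U1 u1 -> U2 u2 -> U (u1 + u2)) ->
  (forall u, U u -> exists u1 u2, [/\ U1 u1, U2 u2 & u = u1 + u2]) ->
  (forall u1 u2, U1 u1 -> U2 u2 -> f u1 u2 = 0) ->
  ind U f = (ind U1 f + ind U2 f)%N.
Proof.
move=> fB s1 s2 sU dec o12.
have [D1 [<- DU1 n1 p1 c1]] := ind_split fB s1.
have [D2 [<- DU2 n2 p2 c2]] := ind_split fB s2.
pose P : set vT := [set u | exists u1 u2,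
  [/\ orth_in f D1 U1 u1, orth_in f D2 U2 u2 & u = u1 + u2]].
have sP : is_subspace P.
  split.
    exists 0, 0; split; [by apply: (is_subspace_orth_in D1 fB s1).1|
      by apply: (is_subspace_orth_in D2 fB s2).1| by rewrite addr0].
  move=> a u v [u1 [u2 [h1 h2 ->]]] [v1 [v2 [k1 k2 ->]]].
  exists (a *: u1 + v1), (a *: u2 + v2); split.
  - exact: (is_subspace_orth_in D1 fB s1).2.
  - exact: (is_subspace_orth_in D2 fB s2).2.
  - by rewrite scalerDr addrACA.
rewrite (ind_eq (D := (D1 + D2)%VS) sP).
- rewrite dimv_disjoint_sum //; apply/eqP; rewrite -subv0; apply/subvP => u.
  case/memv_capP=> u1 u2; rewrite memv0; apply: contraT => u0.
  by have := n1 u u1 u0; rewrite o12 ?ltxx //; [apply: DU1 | apply: DU2].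
- by move=> v /memv_addP[a aD [b bD ->]]; apply: sU; [apply: DU1 | apply: DU2].
- move=> v /memv_addP[a aD [b bD ->]].
  have ab := o12 a b (DU1 a aD) (DU2 b bD); rewrite (sb_sqrD fB) //.
  have [->|a0] := eqVneq a 0; first by rewrite add0r (sb0l fB) // add0r => /n2; apply.
  move=> _; have [->|b0] := eqVneq b 0; first by rewrite (sb0l fB) // addr0 n1.
  by rewrite -[ltRHS]addr0; apply: ltrD; [apply: n1 | apply: n2].
- move=> v [u1 [u2 [h1 h2 ->]]].
  rewrite (sb_sqrD fB); last by apply: o12; [case: h1 | case: h2].
  by apply: addr_ge0; [apply: p1 | apply: p2].
- move=> u /dec[u1 [u2 [h1 h2 ->]]].
  have [d1 dD1 e1] := c1 _ h1; have [d2 dD2 e2] := c2 _ h2.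
  exists (d1 + d2); first by rewrite memv_add.
  by exists (u1 - d1), (u2 - d2); split=> //; rewrite opprD addrACA.
Qed.

(** The index is unchanged under pull-back by a linear surjection, which may
    have a kernel. *)
Lemma ind_pullback vT vT' (U : set vT) (U' : set vT')
    (f : vT -> vT -> R) (f' : vT' -> vT' -> R) (phi : vT -> vT') :
  linear phi -> is_subspace U -> f' 0 0 = 0 ->
  (forall u, U u -> U' (phi u)) ->
  (forall u', U' u' -> exists2 u, U u & phi u = u') ->
  (forall u, U u -> f u u = f' (phi u) (phi u)) ->
  ind U f = ind U' f'.
Proof.
move=> pL sU f0 UU' sur fE.
pose p1 : {linear vT -> vT'} := HB.pack phi (GRing.isLinear.Build _ _ _ _ phi pL).
have pE x : linfun p1 x = phi x by rewrite lfunE.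
apply/eqP; rewrite eqn_leq; apply/andP; split.
  have [D [<- DU nD]] := ind_witness f sU.1.
  have inj : (D :&: lker (linfun p1) = 0)%VS.
    apply/eqP; rewrite -subv0; apply/subvP => v /memv_capP[vD].
    rewrite memv_ker pE memv0 => /eqP Tv; apply: contraT => v0.
    by have := nD v vD v0; rewrite fE ?Tv ?f0 ?ltxx //; apply: DU.
  rewrite -(limg_dim_eq inj); apply: ind_ge => u /memv_imgP[d dD ->].
    by rewrite pE; apply/UU'/DU.
  rewrite pE => d0; rewrite -fE; last exact: DU.
  apply: nD => //; apply: contraNneq d0 => ->.
  by rewrite -pE linear0.
have U'0 : U' 0 by have := UU' _ sU.1; rewrite -[phi 0]pE linear0.
have [D [dD DU nD]] := ind_witness f' U'0; rewrite -dD.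
pose b := vbasis D.
have /choice[g hg] : forall j : 'I_(\dim D), exists u, U u /\ phi u = b`_j.
  move=> j; have [|u Uu pu] := sur b`_j; last by exists u.
  by apply: DU; apply: vbasis_mem; apply: mem_nth; rewrite size_tuple.
(* A lift to U of a basis of the negative definite subspace D. *)
pose X := [seq g j | j <- enum 'I_(\dim D)].
have XU v : v \in <<X>>%VS -> U v.
  apply: subspace_span => // w /mapP[j _ ->]; exact: (hg j).1.
have img : (linfun p1 @: <<X>>)%VS = D.
  rewrite limg_span -(span_basis (vbasisP D)); congr (<< _ >>)%VS.
  apply: (@eq_from_nth _ 0).
    by rewrite size_map /X size_map size_enum_ord size_tuple.
  move=> i; rewrite size_map => iX.
  have iD : (i < \dim D)%N by move: iX; rewrite /X size_map size_enum_ord.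
  rewrite (nth_map 0) // pE /X (nth_map (Ordinal iD)) ?size_enum_ord //.
  rewrite (hg _).2 -/b; congr (b`_ _).
  by rewrite nth_enum_ord.
have dX : \dim <<X>>%VS = \dim D.
  apply/eqP; rewrite eqn_leq; apply/andP; split.
    by rewrite (leq_trans (dim_span _)) // /X size_map size_enum_ord.
  by rewrite -{1}img -(limg_ker_dim (linfun p1) <<X>>) leq_addl.
rewrite -dX; apply: ind_ge => // u uX u0.
have inj : (<<X>> :&: lker (linfun p1) = 0)%VS.
  apply/eqP; rewrite -dimv_eq0 -(eqn_add2r (\dim (linfun p1 @: <<X>>))).
  by rewrite limg_ker_dim img dX.
rewrite fE; last exact: XU.
apply: nD; first by rewrite -pE -img memv_img.
apply: contraNneq u0 => pu.
have : u \in (<<X>> :&: lker (linfun p1))%VS by rewrite memv_cap uX memv_ker pE pu eqxx.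
by rewrite inj memv0.
Qed.

End Index.

(** * Parity of the index and sign of the determinant *)

Section Parity.
Variable R : realType.

Lemma is_subspaceT (vT : vectType R) : is_subspace (@setT vT).
Proof. by split. Qed.

Lemma exists_row_basis m n r (K : 'M[R]_(m, n)) : \rank K = r ->
  exists e : 'M[R]_(r, n), row_free e /\ (e == K)%MS.
Proof.
move=> <-; exists (row_base K).
by rewrite row_base_free; split=> //; apply/eqmxP/eq_row_base.
Qed.

Lemma tr_mx11 (C : 'M[R]_1) : C^T = C.
Proof. by apply/matrixP => i j; rewrite mxE !ord1. Qed.

Lemma pairing_tr k (G : 'M[R]_k) u v : pairing G u v = pairing G^T v u.
Proof.
by rewrite /pairing -[in LHS](tr_mx11 (_ *m _)) !trmx_mul trmxK mulmxA.
Qed.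

Lemma pairing_sym k (G : 'M[R]_k) : G^T = G -> sym_bilinear (pairing G).
Proof.
move=> Gsym; split=> [a u v w|u v]; last by rewrite pairing_tr Gsym.
by rewrite /pairing !mulmxDl -!scalemxAl !mxE.
Qed.

Lemma sgr_sqrMl (a b : R) : a != 0 -> Num.sg (a * b * a) = Num.sg b.
Proof.
move=> a0; rewrite !sgrM mulrAC -sgrM gtr0_sg ?mul1r //.
by rewrite -expr2 exprn_even_gt0.
Qed.

(** Induction on k: split off a vector v with v G v^T <> 0 and its orthogonal
    complement, the kernel of u |-> u G v^T. *)
Lemma sg_det_ind k (G : 'M[R]_k) : G^T = G -> G \in unitmx ->
  (-1) ^+ ind setT (pairing G) = Num.sg (\det G).
Proof.
elim: k G => [|k IH] G Gsym Gunit.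
  rewrite det_mx00 sgr1; suff -> : ind setT (pairing G) = 0%N by rewrite expr0.
  have [D [<- _ _]] := ind_witness (U := setT) (pairing G) I.
  by apply/eqP; rewrite -leqn0 (leq_trans (dimvS (subvf D))) // dimvf /dim /= muln0.
have GB := pairing_sym Gsym.
have [v v0] : exists v, pairing G v v != 0.
  apply: contrapT => nv.
  have G0 v : pairing G v v = 0 by apply/eqP/negPn/negP => h; apply: nv; exists v.
  have G00 u v : pairing G u v = 0.
    have := G0 (u + v); rewrite (sbDl GB) !(sbDr GB) !G0 add0r addr0.
    rewrite (sbC GB v u) -mulr2n.
    by move/eqP; rewrite mulrn_eq0 => /eqP.
  have Gz : G = 0.
    apply/matrixP => i j; have := G00 (delta_mx 0 i) (delta_mx 0 j).
    by rewrite /pairing -rowE trmx_delta -colE !mxE.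
  by move: Gunit; rewrite Gz unitmxE det0 unitr0.
pose a := pairing G v v.
pose c := G *m v^T.
have cE : v *m c = a%:M by rewrite [LHS]mx11_scalar /a /pairing /c mulmxA.
have rkc : \rank c = 1%N.
  apply/eqP; rewrite eqn_leq rank_leq_col lt0n mxrank_eq0; apply: contraNneq v0 => c0.
  by rewrite /pairing -mulmxA -/c c0 mulmx0 mxE.
have rkK : \rank (kermx c) = k by rewrite mxrank_ker rkc subSS subn0.
have [e [eF eK]] : exists e : 'M[R]_(k, k.+1), row_free e /\ (e == kermx c)%MS.
  exact: exists_row_basis.
have ec : e *m c = 0 by apply/sub_kermxP; rewrite (eqmxP eK).
pose T : 'M[R]_(1 + k) := col_mx v e.
have Tu : T \in unitmx.
  rewrite -row_free_unit -kermx_eq0; apply/rowV0P => x /sub_kermxP.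
  rewrite -[x]hsubmxK mul_row_col => h.
  have l0 : lsubmx x = 0.
    have := congr1 (mulmx^~ c) h; rewrite mulmxDl -!mulmxA ec mulmx0 addr0 mul0mx cE.
    rewrite mul_mx_scalar => /eqP; rewrite scaler_eq0.
    by rewrite (negPf (v0 : a != 0)) => /eqP.
  move: h; rewrite l0 mul0mx add0r => h; suff -> : rsubmx x = 0 by rewrite row_mx0.
  by apply/(row_free_inj eF); rewrite mul0mx.
pose H := e *m G *m e^T.
have vGe : v *m G *m e^T = 0.
  by apply: trmx_inj; rewrite !trmx_mul trmxK Gsym -/c ec trmx0.
have TGT : T *m G *m T^T = block_mx a%:M 0 0 H.
  rewrite /T mul_col_mx tr_col_mx mul_col_row vGe -[e *m G *m v^T]mulmxA -/c ec.
  by rewrite -cE /c mulmxA.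
have HT : H^T = H by rewrite /H !trmx_mul trmxK Gsym mulmxA.
have detE : \det T * \det G * \det T = a * \det H.
  by rewrite -{2}(det_tr T) -!det_mulmx TGT det_ublock det_scalar1.
have T0 : \det T != 0 by move: Tu; rewrite unitmxE unitfE.
have Hu : H \in unitmx.
  move: Gunit; rewrite !unitmxE !unitfE; apply: contraNneq => H0.
  by move/eqP: detE; rewrite H0 mulr0 !mulf_eq0 (negPf T0) orbF.
rewrite -(sgr_sqrMl _ T0) detE sgrM -(IH H HT Hu).
pose U1 : set 'rV[R]_k.+1 := [set u | (u <= v)%MS].
pose U2 : set 'rV[R]_k.+1 := [set u | (u <= e)%MS].
have sU1 : is_subspace U1.
  by split=> [|t x y h1 h2]; rewrite /U1 /= ?sub0mx // addmx_sub ?scalemx_sub.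
have sU2 : is_subspace U2.
  by split=> [|t x y h1 h2]; rewrite /U2 /= ?sub0mx // addmx_sub ?scalemx_sub.
rewrite (@ind_orth_sum _ _ setT U1 U2) //; last 2 first.
- move=> u _; exists (lsubmx (u *m invmx T) *m v), (rsubmx (u *m invmx T) *m e).
  split; [exact: submxMl | exact: submxMl|].
  by rewrite -mul_row_col hsubmxK mulmxKV.
- move=> _ _ /submxP[x ->] /submxP[y ->].
  by rewrite /pairing trmx_mul !mulmxA -(mulmxA x) -(mulmxA x) vGe mulmx0 mul0mx mxE.
have -> : ind U2 (pairing G) = ind setT (pairing H).
  apply: esym; apply: (ind_pullback (phi := mulmxr e)) => //.
  - exact: linearP.
  - by rewrite (sb0l GB).
  - by move=> u _; apply: submxMl.
  - by move=> u /submxP[x ->]; exists x.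
  - by move=> u _ /=; rewrite /pairing /H trmx_mul !mulmxA.
rewrite exprD; congr (_ * _).
have vv (t : R) : pairing G (t *: v) (t *: v) = t ^+ 2 * a.
  by rewrite (sbZl GB) (sbZr GB) mulrA.
have vn : v != 0 by apply: contraNneq v0 => ->; rewrite (sb0l GB).
have [an|ap|a0] := ltgtP a 0.
- rewrite ltr0_sg // (@ind_eq _ _ U1 [set 0] _ <[v]>%VS).
  + by rewrite dim_vline vn expr1.
  + by split=> // t x y -> ->; rewrite /= scaler0 addr0.
  + by move=> x /vlineP[t ->]; rewrite /U1 /= scalemx_sub.
  + move=> x /vlineP[t ->] tv; rewrite vv pmulr_rlt0 // exprn_even_gt0 //=.
    by apply: contraNneq tv => ->; rewrite scale0r.
  + by move=> x ->; rewrite (sb0l GB).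
  + move=> u /sub_rVP[t ->]; exists (t *: v); last by rewrite /= subrr.
    by rewrite memvZ // memv_line.
- rewrite gtr0_sg // (@ind_eq _ _ U1 U1 _ 0%VS) //.
  + by rewrite dimv0 expr0.
  + by move=> x; rewrite memv0 => /eqP ->; apply: sU1.1.
  + by move=> x; rewrite memv0 => ->.
  + by move=> u /sub_rVP[t ->]; rewrite vv mulr_ge0 ?sqr_ge0 // ltW.
  + by move=> u Uu; exists 0; rewrite ?mem0v // subr0.
- by move: v0; rewrite -/a a0 eqxx.
Qed.

End Parity.

(** * Symmetry of second directional derivatives *)

Section Schwarz.
Variables (R : realType) (V : normedModType R).
Implicit Types (F : V -> R) (u v p : V).

Lemma is_derive_line F p u (s : R) : derivable F (p + s *: u) u ->
  is_derive s 1 (fun t : R => F (p + t *: u)) ('D_u F (p + s *: u)).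
Proof.
move=> dF.
have E : (fun h : R => h^-1 *: (((fun t : R => F (p + t *: u)) \o shift s) (h *: 1)
      - F (p + s *: u))) =
   (fun h : R => h^-1 *: ((F \o shift (p + s *: u)) (h *: u) - F (p + s *: u))).
  apply/funext => h /=; congr (_ *: (F _ - _)).
  by rewrite [h *: 1]mulr1 scalerDl addrCA.
by apply: DeriveDef; rewrite /derivable /derive E.
Qed.

(** Mean value theorem along a segment. *)
Lemma mvt_line F p u (h : R) : 0 < h ->
  (forall s, 0 <= s <= h -> derivable F (p + s *: u) u) ->
  exists2 s, 0 < s < h & F (p + h *: u) - F p = h * 'D_u F (p + s *: u).
Proof.
move=> h0 dF.
have [||s + E] := @MVT R (fun t => F (p + t *: u)) (fun t => 'D_u F (p + t *: u)) 0 h h0.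
- move=> s; rewrite in_itv /= => /andP[s0 sh].
  by apply: is_derive_line; apply: dF; rewrite !ltW.
- apply: derivable_within_continuous => s; rewrite in_itv /= => sh.
  exact: (@ex_derive _ _ _ _ _ _ _ (is_derive_line (dF s sh))).
rewrite in_itv /= => sh; exists s => //.
by move: E; rewrite scale0r addr0 subr0 mulrC.
Qed.

(** The mixed second difference is a mixed second derivative at an intermediate point. *)
Lemma second_difference F p u v (h : R) : 0 < h ->
  (forall s t, 0 <= s <= h -> 0 <= t <= h ->
     [/\ derivable F (p + s *: u + t *: v) u
       & derivable ('D_u F) (p + s *: u + t *: v) v]) ->
  exists s t, [/\ 0 < s < h, 0 < t < h &
    F (p + h *: u + h *: v) - F (p + h *: u) - (F (p + h *: v) - F p)
    = h * (h * 'D_v ('D_u F) (p + s *: u + t *: v))].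
Proof.
move=> h0 dF.
have h00 : 0 <= (0 : R) <= h by rewrite lexx ltW.
have hhh : 0 <= h <= h by rewrite lexx ltW.
pose Fv x := F (x + h *: v) - F x.
(* The mean value theorem is applied to Fv along u, then to 'D_u F along v. *)
have dFv s : 0 <= s <= h ->
    derivable Fv (p + s *: u) u /\
    'D_u Fv (p + s *: u) = 'D_u F (p + s *: u + h *: v) - 'D_u F (p + s *: u).
  move=> sh.
  have d1 : derivable F (p + s *: u) u.
    by have [] := dF s 0 sh h00; rewrite scale0r addr0.
  have [d2 _] := dF s h sh hhh.
  have E : (fun x : V => F (x + h *: v)) = F \o shift (h *: v) by [].
  have q x : (fun k : R => k^-1 *: (((F \o shift (h *: v)) \o shift x) (k *: u)
     - (F \o shift (h *: v)) x)) =
     (fun k : R => k^-1 *: ((F \o shift (x + h *: v)) (k *: u) - F (x + h *: v))).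
    by apply/funext => k /=; rewrite addrA.
  have d3 : derivable (F \o shift (h *: v)) (p + s *: u) u.
    by rewrite /derivable q.
  split; first exact: derivableB d3 d1.
  rewrite [LHS](deriveB d3 d1); congr (_ - _).
  by rewrite /derive q.
have [s sh E1] := mvt_line h0 (fun s sh => (dFv s sh).1).
have sh' : 0 <= s <= h by case/andP: sh => ? ?; rewrite !ltW.
have [t th E2] := mvt_line (p := p + s *: u) h0 (fun t th => (dF s t sh' th).2).
exists s, t; split=> //.
by rewrite -E2 -(dFv s sh').2 -E1.
Qed.

Lemma continuous_near_dist (f : V -> R) p (e : R) : {for p, continuous f} -> 0 < e ->
  \forall x \near p, `|f p - f x| < e.
Proof. by move=> cf e0; apply: cvgr_dist_lt. Qed.

(** The second difference with steps h u and h v is symmetric in u and v, and by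
    second_difference it equals h^2 times either mixed derivative at points
    that tend to p with h. *)
Lemma schwarz F p u v (U : set V) : open U -> U p -> C2_on U F ->
  'D_v ('D_u F) p = 'D_u ('D_v F) p.
Proof.
move=> oU Up C2.
pose f1 := 'D_v ('D_u F); pose f2 := 'D_u ('D_v F).
have c1 : {for p, continuous f1} by have [_ /(_ u)[_ [_ /(_ v)[]]]] := C2 p Up.
have c2 : {for p, continuous f2} by have [_ /(_ v)[_ [_ /(_ u)[]]]] := C2 p Up.
have dU x u' v' : U x -> derivable F x u' /\ derivable ('D_u' F) x v'.
  by move=> /C2[_ /(_ u')[? [_ /(_ v')[? _]]]].
suff : f1 p = f2 p by [].
apply/eqP; rewrite -subr_eq0 -normr_le0; apply/ler_addgt0Pl => e e0; rewrite addr0.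
have e2 : 0 < e / 2 by rewrite divr_gt0.
have : \forall x \near p, U x /\ (`|f1 p - f1 x| < e / 2 /\ `|f2 p - f2 x| < e / 2).
  have n0 : \forall x \near p, U x by apply: open_nbhs_nbhs.
  exact: (filterI n0 (filterI (continuous_near_dist c1 e2)
                              (continuous_near_dist c2 e2))).
case/nbhs_ballP => r /= r0 br.
(* The added 1 keeps the denominator positive and the estimate strict. *)
pose h := r / (`|u| + `|v| + 1).
have n1 : 0 < `|u| + `|v| + 1 by rewrite ltr_wpDl ?addr_ge0.
have h0 : 0 < h by rewrite divr_gt0.
have inb s t : 0 <= s <= h -> 0 <= t <= h -> ball p r (p + s *: u + t *: v).
  move=> /andP[s0 sh] /andP[t0 th].
  rewrite -ball_normE /ball_ /= -addrA opprD addrA subrr add0r normrN.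
  rewrite (le_lt_trans (ler_normD _ _)) // !normrZ (ger0_norm s0) (ger0_norm t0).
  have -> : r = h * `|u| + h * `|v| + h.
    by rewrite -[X in _ + X]mulr1 -!mulrDr /h divfK ?gt_eqF.
  by rewrite -[ltLHS]addr0 ler_ltD // lerD // ler_wpM2r.
have subh (s : R) : 0 < s < h -> 0 <= s <= h by case/andP=> ? ?; rewrite !ltW.
have [s [t [sh th E1]]] := second_difference h0
  (fun s t sh th => dU _ u v (br _ (inb _ _ sh th)).1).
have [|s' [t' [sh' th' E2]]] := @second_difference F p v u h h0.
  by move=> s' t' sh' th'; rewrite addrAC; apply: dU (br _ (inb _ _ th' sh')).1.
have [_ [h1 _]] := br _ (inb _ _ (subh _ sh) (subh _ th)).
have [_ [_ h2]] := br _ (inb _ _ (subh _ th') (subh _ sh')).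
have E3 : f1 (p + s *: u + t *: v) = f2 (p + t' *: u + s' *: v).
  apply: (mulfI (lt0r_neq0 h0)); apply: (mulfI (lt0r_neq0 h0)).
  rewrite [in RHS]addrAC; apply: etrans (esym E1) (etrans _ E2).
  by rewrite [p + h *: v + h *: u]addrAC; ring.
have -> : f1 p - f2 p = (f1 p - f1 (p + s *: u + t *: v))
    - (f2 p - f2 (p + t' *: u + s' *: v)).
  by rewrite E3 opprB addrA subrK.
apply: (le_trans (ler_normB _ _)); apply: ltW; rewrite (splitr e).
exact: (ltrD h1 h2).
Qed.
End Schwarz.

(** * Periodic sequences *)

(** Sequences over the integers with period n. *)
Definition nperiodic (n : nat) (T : Type) (F : int -> T) : Prop :=
  forall i, F (i + n%:Z) = F i.

(** Sum over one period. *)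
Definition psum (n : nat) (V : zmodType) (F : int -> V) : V :=
  \sum_(1 <= i < n.+1) F i%:Z.

Section Periodic.
Variable n : nat.

Lemma periodicN (T : Type) (F : int -> T) : nperiodic n F -> F n%:Z = F 0.
Proof. by move=> pF; rewrite -(pF 0) add0r. Qed.

Lemma periodic_shift (T : Type) (F : int -> T) (j : int) :
  nperiodic n F -> nperiodic n (fun i => F (i + j)).
Proof. by move=> pF i; rewrite addrAC pF. Qed.

Lemma psum0 (V : zmodType) (F : int -> V) : nperiodic n F ->
  psum n F = \sum_(0 <= i < n) F i%:Z.
Proof.
move=> pF; apply/eqP; rewrite -subr_eq0 /psum big_add1 /= -sumrB.
rewrite (telescope_sumr (fun i : nat => F i%:Z)) //.
by rewrite (periodicN pF) subrr.
Qed.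

Lemma psum_shift (V : zmodType) (F : int -> V) : nperiodic n F ->
  psum n (fun i => F (i - 1)) = psum n F.
Proof.
move=> pF; rewrite [RHS]psum0 // /psum big_add1 /=.
by apply: eq_bigr => i _; rewrite -addn1 PoszD addrK.
Qed.

Lemma psumD (V : zmodType) (F F' : int -> V) :
  psum n (fun i => F i + F' i) = psum n F + psum n F'.
Proof. exact: big_split. Qed.

Lemma psumB (V : zmodType) (F F' : int -> V) :
  psum n (fun i => F i - F' i) = psum n F - psum n F'.
Proof. exact: sumrB. Qed.

Lemma eq_psum (V : zmodType) (F F' : int -> V) :
  (forall i, F i = F' i) -> psum n F = psum n F'.
Proof. by move=> FF; apply: eq_bigr. Qed.

Lemma psum_tr (R : realType) r r' (F : int -> 'M[R]_(r, r')) :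
  (psum n F)^T = psum n (fun i => (F i)^T).
Proof. by rewrite /psum linear_sum. Qed.

Lemma psum_mull (R : realType) r r' p (y : 'M[R]_(p, r)) (F : int -> 'M[R]_(r, r')) :
  psum n (fun i => y *m F i) = y *m psum n F.
Proof. by rewrite /psum mulmx_sumr. Qed.

(** The n-periodic sequence with values s 0, ..., s (n - 1) at 0, ..., n - 1. *)
Definition pextend (T : Type) (s : nat -> T) (i : int) : T := s `|(i %% n%:Z)%Z|%N.

Lemma pextend_periodic (T : Type) (s : nat -> T) : nperiodic n (pextend s).
Proof. by move=> i; rewrite /pextend modzDr. Qed.

Lemma pextend_lt (T : Type) (s : nat -> T) (j : nat) : (j < n)%N -> pextend s j%:Z = s j.
Proof. by move=> jn; rewrite /pextend modz_nat absz_nat modn_small. Qed.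

Lemma pextend_le (T : Type) (s : nat -> T) (j : nat) :
  s n = s 0%N -> (j <= n)%N -> pextend s j%:Z = s j.
Proof.
move=> s0; rewrite leq_eqVlt => /orP[/eqP ->|]; last exact: pextend_lt.
by rewrite /pextend modzz s0.
Qed.

Lemma periodic_mod (T : Type) (F : int -> T) (i : int) : (0 < n)%N ->
  nperiodic n F -> F i = F `|(i %% n%:Z)%Z|%N%:Z.
Proof.
move=> n0 pF; have n0' : n%:Z != 0 by rewrite -lt0n.
have psM (a : nat) j : F (j + n%:Z * a%:Z) = F j.
  elim: a j => [|a IHa] j; first by rewrite mulr0 addr0.
  by rewrite intS mulrDr mulr1 addrA IHa pF.
have psZ (z j : int) : F (j + z * n%:Z) = F j.
  case: z => a; first by rewrite mulrC psM.
  by rewrite NegzE mulNr -(psM a.+1 (j - _)) [n%:Z * _]mulrC subrK.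
by rewrite gez0_abs ?modz_ge0 // [in LHS](divz_eq i n%:Z) addrC psZ.
Qed.

Lemma mod_lt (i : int) : (0 < n)%N -> (`|(i %% n%:Z)%Z| < n)%N.
Proof.
move=> n0; have n0' : n%:Z != 0 by rewrite -lt0n.
by rewrite -ltz_nat gez0_abs ?modz_ge0 // ltz_pmod.
Qed.

Lemma periodic_ext (T : Type) (F F' : int -> T) : (0 < n)%N ->
  nperiodic n F -> nperiodic n F' -> (forall j : nat, (j < n)%N -> F j%:Z = F' j%:Z) ->
  forall i, F i = F' i.
Proof.
move=> n0 pF pF' FF i.
by rewrite (periodic_mod i n0 pF) (periodic_mod i n0 pF') FF // mod_lt.
Qed.

Section Per.
Variables (R : realType) (p : nat).
Implicit Types (u v : 'M[R]_(n, p)).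
Hypothesis n0 : (0 < n)%N.

(** Inverse of per: the matrix of the values of s at 0, ..., n - 1. *)
Definition per_of (s : int -> 'rV[R]_p) : 'M[R]_(n, p) := \matrix_(j < n) s (j : nat)%:Z.

Lemma per_per_of s : nperiodic n s -> per (per_of s) = s.
Proof. exact: perP. Qed.

Lemma per_row u (j : 'I_n) : per u (j : nat)%:Z = row j u.
Proof.
rewrite /per modz_nat absz_nat modn_small //.
by case: insubP => [i _ ij|]; [congr row; apply: val_inj | rewrite ltn_ord].
Qed.

Lemma per_periodic u : nperiodic n (per u).
Proof. by move=> i; rewrite /per modzDr. Qed.

Lemma per_lin a u v i : per (a *: u + v) i = a *: per u i + per v i.
Proof. by rewrite /per; case: insub => [j|]; rewrite ?linearP // scaler0 addr0. Qed.

Lemma perD u v i : per (u + v) i = per u i + per v i.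
Proof. by rewrite /per; case: insub => [j|]; rewrite ?linearD // addr0. Qed.

Lemma perB u v i : per (u - v) i = per u i - per v i.
Proof. by rewrite /per; case: insub => [j|]; rewrite ?linearB // subr0. Qed.

Lemma per0 i : per (0 : 'M[R]_(n, p)) i = 0.
Proof. by rewrite /per; case: insub => [j|] //; rewrite linear0. Qed.

Lemma per_of_lin a s t : per_of (fun i => a *: s i + t i) = a *: per_of s + per_of t.
Proof. by apply/matrixP => i j; rewrite !mxE. Qed.

Lemma per_ofK u : per_of (per u) = u.
Proof. by apply/row_matrixP => j; rewrite rowK per_row. Qed.

Lemma eq_per_of s t : (forall i, s i = t i) -> per_of s = per_of t.
Proof. by move=> st; apply/matrixP => i j; rewrite !mxE st. Qed.

End Per.
End Periodic.

(** * The Hessian in coordinates adapted to the fixed trajectories *)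

(** All forms are taken on sequences of matrices, whose rows are treated in
    parallel; the value is then the matrix of products of the rows. *)

Section Sequences.
Variables (R : realType) (m n k : nat) (A B : int -> 'M[R]_m) (W : int -> 'M[R]_(k, m)).

(** The row-wise version of variation. *)
Definition variation_mx r (u : int -> 'M[R]_(r, m)) (i : int) : 'M[R]_(r, m) :=
  u i *m A i - u (i - 1) *m B (i - 1) - u (i + 1) *m (B i)^T.

(** The Hessian h; see hformE. *)
Definition hess_mx r r' (u : int -> 'M[R]_(r, m)) (v : int -> 'M[R]_(r', m)) :
    'M[R]_(r, r') :=
  psum n (fun i => variation_mx u i *m (v i)^T).

(** The matrix G_i, when the rows of W i are the w_i^a; see gramE. *)
Definition gram (i : int) : 'M[R]_k := W i *m B i *m (W (i + 1))^T.

(** The numbers <B_i v_i, w_{i+1}^a>, called beta_i(v) above. *)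
Definition beta_mx r (v : int -> 'M[R]_(r, m)) (i : int) : 'M[R]_(r, k) :=
  v i *m B i *m (W (i + 1))^T.

(** v_i lies in E_i^perp for all i. *)
Definition perp r (v : int -> 'M[R]_(r, m)) : Prop :=
  forall i, v i *m (W (i - 1) *m B (i - 1))^T = 0.

(** For u in E_i, the row u *m coef_mx i gives the coordinates of the component
    of u in the row space of W i, along E_i^perp. *)
Definition coef_mx (i : int) : 'M[R]_(m, k) :=
  (W (i - 1) *m B (i - 1))^T *m invmx (gram (i - 1)).

(** The polarization of Q on pairs (v, d), with values for d and d' that need not
    be differences of periodic sequences. *)
Definition zform_mx r r' (v : int -> 'M[R]_(r, m)) (d : int -> 'M[R]_(r, k))
    (v' : int -> 'M[R]_(r', m)) (d' : int -> 'M[R]_(r', k)) : 'M[R]_(r, r') :=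
  hess_mx v v' - psum n (fun i => d i *m (beta_mx v' i)^T + beta_mx v i *m (d' i)^T)
  + psum n (fun i => d i *m gram i *m (d' i)^T).

(** The forward difference of the coordinates along W. *)
Definition cdiff r (c : int -> 'M[R]_(r, k)) (i : int) := c (i + 1) - c i.

Hypothesis AT : forall i, (A i)^T = A i.
Hypothesis pB : nperiodic n B.
Hypothesis pW : nperiodic n W.

Lemma pWS i : W (i + n%:Z + 1) = W (i + 1).
Proof. by rewrite addrAC pW. Qed.

Lemma beta_mx_periodic r (v : int -> 'M[R]_(r, m)) :
  nperiodic n v -> nperiodic n (beta_mx v).
Proof. by move=> pv i; rewrite /beta_mx pv pB pWS. Qed.

Lemma gram_periodic : nperiodic n gram.
Proof. by move=> i; rewrite /gram pW pB pWS. Qed.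

Lemma coef_mx_periodic : nperiodic n coef_mx.
Proof. by move=> i; rewrite /coef_mx (addrAC i n%:Z (-1)) pW pB gram_periodic. Qed.

(** Only the term in A and the cross term of consecutive indices remain, which
    makes the symmetry of h visible. *)
Lemma hess_mxE r r' (u : int -> 'M[R]_(r, m)) (v : int -> 'M[R]_(r', m)) :
  nperiodic n u -> nperiodic n v ->
  hess_mx u v = psum n (fun i => u i *m A i *m (v i)^T)
    - psum n (fun i => u i *m B i *m (v (i + 1))^T)
    - (psum n (fun i => v i *m B i *m (u (i + 1))^T))^T.
Proof.
move=> pu pv; rewrite psum_tr -[X in _ - X - _]psum_shift; last first.
  by move=> i; rewrite pu pB addrAC pv.
rewrite -!psumB; apply: eq_psum => i.
by rewrite /variation_mx !mulmxBl !trmx_mul trmxK subrK !mulmxA.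
Qed.

Lemma hess_mx_tr r r' (u : int -> 'M[R]_(r, m)) (v : int -> 'M[R]_(r', m)) :
  nperiodic n u -> nperiodic n v -> (hess_mx u v)^T = hess_mx v u.
Proof.
move=> pu pv; rewrite !hess_mxE // !linearB /= trmxK addrAC; congr (_ - _ - _).
by rewrite psum_tr; apply: eq_psum => i; rewrite !trmx_mul trmxK AT mulmxA.
Qed.

Lemma variation_mx_mull r p (y : 'M[R]_(p, r)) (u : int -> 'M[R]_(r, m)) i :
  variation_mx (fun i => y *m u i) i = y *m variation_mx u i.
Proof. by rewrite /variation_mx !mulmxBr !mulmxA. Qed.

Lemma variation_mxD r (u v : int -> 'M[R]_(r, m)) i :
  variation_mx (fun i => u i + v i) i = variation_mx u i + variation_mx v i.
Proof.
rewrite /variation_mx !mulmxDl !opprD (addrACA (u i *m A i)).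
by rewrite (addrACA (u i *m A i - _)).
Qed.

Lemma hess_mx_mull r r' p (y : 'M[R]_(p, r)) (u : int -> 'M[R]_(r, m))
    (v : int -> 'M[R]_(r', m)) :
  hess_mx (fun i => y *m u i) v = y *m hess_mx u v.
Proof.
by rewrite /hess_mx -psum_mull; apply: eq_psum => i; rewrite variation_mx_mull mulmxA.
Qed.

Lemma hess_mxDl r r' (u u' : int -> 'M[R]_(r, m)) (v : int -> 'M[R]_(r', m)) :
  hess_mx (fun i => u i + u' i) v = hess_mx u v + hess_mx u' v.
Proof.
by rewrite /hess_mx -psumD; apply: eq_psum => i; rewrite variation_mxD mulmxDl.
Qed.

Lemma hess_mxDr r r' (u : int -> 'M[R]_(r, m)) (v v' : int -> 'M[R]_(r', m)) :
  hess_mx u (fun i => v i + v' i) = hess_mx u v + hess_mx u v'.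
Proof. by rewrite /hess_mx -psumD; apply: eq_psum => i; rewrite linearD mulmxDr. Qed.

Hypothesis gram_tr : forall i, (gram i)^T = gram i.
Hypothesis gram_unit : forall i, gram i \in unitmx.
Hypothesis tW : forall i, variation_mx W i = 0.

(** Variation of constants in the trajectories W. *)
Lemma variation_mxW r (c : int -> 'M[R]_(r, k)) i :
  variation_mx (fun i => c i *m W i) i =
  cdiff c (i - 1) *m (W (i - 1) *m B (i - 1)) - cdiff c i *m (W (i + 1) *m (B i)^T).
Proof.
have /eqP := tW i; rewrite /variation_mx -addrA -opprD subr_eq0 => /eqP WA.
rewrite /cdiff subrK -mulmxA WA !mulmxBl mulmxDr !mulmxA.
rewrite -!addrA; congr (_ + _); rewrite addrC -!addrA; congr (_ + _).
by rewrite opprB addrC.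
Qed.

Lemma hess_mxW_perp r r' (c : int -> 'M[R]_(r, k)) (v : int -> 'M[R]_(r', m)) : perp v ->
  hess_mx (fun i => c i *m W i) v = - psum n (fun i => cdiff c i *m (beta_mx v i)^T).
Proof.
move=> pv; rewrite /hess_mx /psum -sumrN; apply: eq_bigr => i _.
have pvT : W (i%:Z - 1) *m B (i%:Z - 1) *m (v i%:Z)^T = 0.
  by apply: trmx_inj; rewrite trmx_mul trmxK pv trmx0.
rewrite variation_mxW mulmxBl -mulmxA pvT mulmx0 sub0r; congr (- _).
by rewrite /beta_mx !trmx_mul trmxK !mulmxA.
Qed.

Lemma hess_mxWW r r' (c : int -> 'M[R]_(r, k)) (c' : int -> 'M[R]_(r', k)) :
  nperiodic n c -> nperiodic n c' ->
  hess_mx (fun i => c i *m W i) (fun i => c' i *m W i)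
  = psum n (fun i => cdiff c i *m gram i *m (cdiff c' i)^T).
Proof.
move=> pc pc'.
transitivity (psum n (fun i => cdiff c (i - 1) *m gram (i - 1) *m (c' (i - 1 + 1))^T
    - cdiff c i *m gram i *m (c' i)^T)).
  apply: eq_psum => i; rewrite variation_mxW mulmxBl; congr (_ - _).
    by rewrite /gram subrK trmx_mul !mulmxA.
  by rewrite -[in RHS]gram_tr /gram !trmx_mul trmxK !mulmxA.
rewrite psumB (psum_shift (F := fun i => cdiff c i *m gram i *m (c' (i + 1))^T)).
  by rewrite -psumB; apply: eq_psum => i; rewrite -mulmxBr -linearB.
by move=> i; rewrite /cdiff gram_periodic !(addrAC _ n%:Z) !pc pc'.
Qed.

(** h in the splitting E_i = E_i^perp + W_i. *)
Lemma hess_mx_zform r r' (v : int -> 'M[R]_(r, m)) (c : int -> 'M[R]_(r, k))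
    (v' : int -> 'M[R]_(r', m)) (c' : int -> 'M[R]_(r', k)) :
  nperiodic n v -> nperiodic n c -> nperiodic n v' -> nperiodic n c' ->
  perp v -> perp v' ->
  hess_mx (fun i => v i + c i *m W i) (fun i => v' i + c' i *m W i)
  = zform_mx v (cdiff c) v' (cdiff c').
Proof.
move=> pv pc pv' pc' hv hv'.
rewrite hess_mxDl !hess_mxDr hess_mxWW // hess_mxW_perp //.
rewrite -(@hess_mx_tr _ _ (fun i => c' i *m W i)) //; last first.
  by move=> i; rewrite pc' pW.
rewrite hess_mxW_perp // linearN /= psum_tr /zform_mx psumD opprD !addrA; congr (_ + _).
rewrite addrAC; congr (_ - _ - _).
by apply: eq_psum => i; rewrite trmx_mul trmxK.
Qed.

Lemma coef_mxW i : W i *m coef_mx i = 1%:M.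
Proof.
rewrite /coef_mx mulmxA.
have -> : W i *m (W (i - 1) *m B (i - 1))^T = gram (i - 1).
  by rewrite -gram_tr /gram subrK [in RHS]trmx_mul trmxK.
by rewrite mulmxV.
Qed.

Lemma coef_mx_perp r (v : int -> 'M[R]_(r, m)) i : perp v -> v i *m coef_mx i = 0.
Proof. by move=> pv; rewrite /coef_mx mulmxA pv mul0mx. Qed.

Lemma perp_proj r (u : int -> 'M[R]_(r, m)) :
  perp (fun i => u i - u i *m coef_mx i *m W i).
Proof.
move=> i; rewrite mulmxBl /coef_mx -[X in _ - X]mulmxA.
have -> : W i *m (W (i - 1) *m B (i - 1))^T = gram (i - 1).
  by rewrite -gram_tr /gram subrK [in RHS]trmx_mul trmxK.
by rewrite mulmxA mulmxKV // subrr.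
Qed.

(** The form h^perp; see hperpE. *)
Definition hperp_mx r r' (v : int -> 'M[R]_(r, m)) (v' : int -> 'M[R]_(r', m)) :=
  hess_mx v v' - psum n (fun i => beta_mx v i *m invmx (gram i) *m (beta_mx v' i)^T).

Lemma gram_inv_tr i : (invmx (gram i))^T = invmx (gram i).
Proof. by rewrite trmx_inv gram_tr. Qed.

(** At d_i = beta_i(v) G_i^-1, where the squares vanish, Q reduces to h^perp. *)
Lemma zform_mx_hperp r r' (v : int -> 'M[R]_(r, m)) (v' : int -> 'M[R]_(r', m)) :
  zform_mx v (fun i => beta_mx v i *m invmx (gram i))
           v' (fun i => beta_mx v' i *m invmx (gram i))
  = hperp_mx v v'.
Proof.
rewrite /zform_mx /hperp_mx -addrA; congr (_ + _).
rewrite addrC -psumB /psum -sumrN; apply: eq_bigr => i _.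
by rewrite trmx_mul gram_inv_tr mulmxKV // !mulmxA opprD addrA subrr add0r.
Qed.

(** Hence (v, d) is Q-orthogonal to every (0, d') supported at an index i where
    d_i = beta_i(v) G_i^-1. *)
Lemma zform_mx_0r r r' (v : int -> 'M[R]_(r, m)) (d : int -> 'M[R]_(r, k))
    (d' : int -> 'M[R]_(r', k)) :
  zform_mx v d (fun _ => 0) d' =
  psum n (fun i => (d i *m gram i - beta_mx v i) *m (d' i)^T).
Proof.
rewrite /zform_mx.
have -> : hess_mx v (fun _ => 0 : 'M[R]_(r', m)) = 0.
  by rewrite /hess_mx /psum big1 // => i _; rewrite trmx0 mulmx0.
rewrite sub0r addrC -psumB; apply: eq_psum => i.
by rewrite /beta_mx !mul0mx trmx0 mulmx0 add0r mulmxBl.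
Qed.

Lemma zform_mx_mull r r' p (y : 'M[R]_(p, r))
    (v : int -> 'M[R]_(r, m)) (d : int -> 'M[R]_(r, k))
    (v' : int -> 'M[R]_(r', m)) (d' : int -> 'M[R]_(r', k)) :
  zform_mx (fun i => y *m v i) (fun i => y *m d i) v' d' = y *m zform_mx v d v' d'.
Proof.
rewrite /zform_mx hess_mx_mull mulmxDr mulmxBr -!psum_mull; congr (_ - _ + _).
  by apply: eq_psum => i; rewrite /beta_mx mulmxDr !mulmxA.
by apply: eq_psum => i; rewrite !mulmxA.
Qed.

Lemma zform_mxDl r r' (v1 v2 : int -> 'M[R]_(r, m)) (d1 d2 : int -> 'M[R]_(r, k))
    (v' : int -> 'M[R]_(r', m)) (d' : int -> 'M[R]_(r', k)) :
  zform_mx (fun i => v1 i + v2 i) (fun i => d1 i + d2 i) v' d' =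
  zform_mx v1 d1 v' d' + zform_mx v2 d2 v' d'.
Proof.
rewrite /zform_mx hess_mxDl addrACA; congr (_ + _); last first.
  by rewrite -psumD; apply: eq_psum => i; rewrite !mulmxDl.
rewrite addrACA -opprD; congr (_ - _).
by rewrite -psumD; apply: eq_psum => i; rewrite /beta_mx !mulmxDl addrACA.
Qed.

Lemma zform_mx_tr r r' (v : int -> 'M[R]_(r, m)) (d : int -> 'M[R]_(r, k))
    (v' : int -> 'M[R]_(r', m)) (d' : int -> 'M[R]_(r', k)) :
  nperiodic n v -> nperiodic n v' -> (zform_mx v d v' d')^T = zform_mx v' d' v d.
Proof.
move=> pv pv'; rewrite /zform_mx !linearD linearN /= hess_mx_tr // !psum_tr.
congr (_ - _ + _).
  by apply: eq_psum => i; rewrite linearD /= !trmx_mul !trmxK addrC.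
by apply: eq_psum => i; rewrite trmx_mul (trmx_mul (d i)) trmxK gram_tr mulmxA.
Qed.

(** The first hypothesis is the conservation of omega against the trajectories W,
    the second the equation of motion in the direction of E_i^perp; both hold
    for the pair (v, d) of quasi_periodic_data. *)
Lemma zform_mx_trajectory r (v : int -> 'M[R]_(k, m)) (d : int -> 'M[R]_(k, k))
    (v' : int -> 'M[R]_(r, m)) (d' : int -> 'M[R]_(r, k)) :
  (forall i : nat, (0 < i <= n)%N -> d i%:Z *m gram i%:Z - beta_mx v i%:Z = 1%:M) ->
  (forall i : nat, (0 < i <= n)%N ->
     variation_mx v i%:Z *m (v' i%:Z)^T = d i%:Z *m (beta_mx v' i%:Z)^T) ->
  zform_mx v d v' d' = psum n (fun i => (d' i)^T).
Proof.
move=> h1 h2; rewrite /zform_mx /hess_mx -psumB -psumD; apply: eq_big_nat => i i1.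
rewrite ltnS in i1.
by rewrite h2 // opprD addrA subrr sub0r addrC -mulmxBl h1 // mul1mx.
Qed.

End Sequences.

(** * The two splittings of the form Q *)

Section IndexIdentity.
Variables (R : realType) (m n k : nat) (A B : int -> 'M[R]_m) (W : int -> 'M[R]_(k, m)).
Hypothesis n0 : (0 < n)%N.
Hypothesis AT : forall i, (A i)^T = A i.
Hypothesis pB : nperiodic n B.
Hypothesis pW : nperiodic n W.
Hypothesis gram_tr : forall i, (gram B W i)^T = gram B W i.
Hypothesis gram_unit : forall i, gram B W i \in unitmx.
Hypothesis tW : forall i, variation_mx A B W i = 0.

Local Notation G := (gram B W).
Local Notation bt := (beta_mx B W).
Local Notation q := (zform_mx n A B W).
Local Notation Z := ('M[R]_(n, m) * 'M[R]_(n, k))%type.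

(** The form Q, on all pairs; v is restricted to X^perp by Zperp. *)
Definition zform (z z' : Z) : R := q (per z.1) (per z.2) (per z'.1) (per z'.2) 0 0.

Lemma hformE (u v : 'M[R]_(n, m)) : hform A B u v = hess_mx n A B (per u) (per v) 0 0.
Proof. by rewrite /hform /hess_mx /psum summxE. Qed.

Lemma per_linE p (a : R) (u v : 'M[R]_(n, p)) :
  per (a *: u + v) = (fun i => a%:M *m per u i + per v i).
Proof. by apply/funext => i; rewrite per_lin mul_scalar_mx. Qed.

Lemma zform_bilinear : sym_bilinear zform.
Proof.
split=> [a u v w|u v]; last first.
  by rewrite /zform -[in LHS](@zform_mx_tr _ _ _ _ A B W) ?mxE //; apply: per_periodic.
rewrite /zform.
have -> : (a *: u + v).1 = a *: u.1 + v.1 by [].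
have -> : (a *: u + v).2 = a *: u.2 + v.2 by [].
by rewrite !per_linE zform_mxDl zform_mx_mull mul_scalar_mx !mxE.
Qed.

(** The space Z of pairs (v, d) with v in X^perp. *)
Definition Zperp : set Z := [set z | perp B W (per z.1)].

Lemma perp_lin r a (v v' : int -> 'M[R]_(r, m)) : perp B W v -> perp B W v' ->
  perp B W (fun i => a *: v i + v' i).
Proof. by move=> h h' i; rewrite mulmxDl -scalemxAl h h' scaler0 addr0. Qed.

Lemma perp_per_lin a (u v : 'M[R]_(n, m)) : perp B W (per u) -> perp B W (per v) ->
  perp B W (per (a *: u + v)).
Proof. by move=> h h' i; rewrite per_lin perp_lin. Qed.

Lemma perp_per0 : perp B W (per (0 : 'M[R]_(n, m))).
Proof. by move=> i; rewrite per0 mul0mx. Qed.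

(** The subspace K of pairs with v in X^perp and sum_i d_i = 0. *)
Definition Zsum0 : set Z := [set z | Zperp z /\ psum n (per z.2) = 0].

Lemma psum_per_lin p a (u v : 'M[R]_(n, p)) :
  psum n (per (a *: u + v)) = a *: psum n (per u) + psum n (per v).
Proof.
rewrite per_linE psumD psum_mull mul_scalar_mx.
by congr (_ *: _ + _).
Qed.

Lemma is_subspace_Zsum0 : is_subspace Zsum0.
Proof.
split.
  split; first exact: perp_per0.
  by rewrite /psum big1 // => i _; rewrite per0.
move=> a u v [u1 u2] [v1 v2]; split; first exact: perp_per_lin.
by rewrite psum_per_lin u2 v2 scaler0 addr0.
Qed.

(** A periodic sequence of sum zero is the difference of a periodic sequence. *)
Lemma cdiff_surj r (d : int -> 'M[R]_(r, k)) : nperiodic n d -> psum n d = 0 ->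
  exists2 c, nperiodic n c & forall i, cdiff c i = d i.
Proof.
move=> pd sd; pose s (j : nat) := \sum_(0 <= i < j) d i%:Z.
have sn : s n = s 0%N by rewrite {2}/s big_geq // /s -psum0.
exists (pextend n s); first exact: pextend_periodic.
apply: (periodic_ext n0) => //.
  by move=> i; rewrite /cdiff addrAC !pextend_periodic.
move=> j jn; rewrite /cdiff -PoszD addn1 !pextend_le //; last exact: ltnW.
by rewrite /s big_nat_recr //= addrAC subrr add0r.
Qed.

(** The map v + cW |-> (v, d), d_i = c_{i+1} - c_i, sends X onto K and Q back to
    h. Its kernel V does not affect the index. *)
Lemma ind_hform : ind setT (hform (n := n) A B) = ind Zsum0 zform.
Proof.
pose pc (u : 'M[R]_(n, m)) i := per u i *m coef_mx B W i.
pose pv (u : 'M[R]_(n, m)) i := per u i - pc u i *m W i.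
pose phi (u : 'M[R]_(n, m)) : Z := (per_of n (pv u), per_of n (cdiff (pc u))).
have ppc u : nperiodic n (pc u).
  by move=> i; rewrite /pc per_periodic (coef_mx_periodic pB pW).
have ppv u : nperiodic n (pv u).
  by move=> i; rewrite /pv per_periodic ppc pW.
have pdel (c : int -> 'rV[R]_k) : nperiodic n c -> nperiodic n (cdiff c).
  by move=> p i; rewrite /cdiff addrAC !p.
apply: (ind_pullback (phi := phi)).
- move=> a u v; rewrite /phi; congr pair.
    rewrite -per_of_lin; apply: eq_per_of => i.
    rewrite /pv /pc per_lin !mulmxDl -!scalemxAl.
    by rewrite opprD addrACA -scalerBr.
  rewrite -per_of_lin; apply: eq_per_of => i.
  rewrite /cdiff /pc !per_lin !mulmxDl -!scalemxAl.
  by rewrite opprD addrACA -scalerBr.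
- exact: is_subspaceT.
- by rewrite (sb0l zform_bilinear).
- move=> u _; split; rewrite /Zperp /phi /= per_per_of //; last 1 first.
  + exact: pdel.
  + exact: perp_proj.
  + rewrite /cdiff psumB; apply/eqP; rewrite subr_eq0; apply/eqP.
    rewrite -(psum_shift (F := fun i => pc u (i + 1))); last exact: periodic_shift.
    by apply: eq_psum => i; rewrite subrK.
- move=> [v d] [/= hv hd].
  have [c pC cd] := cdiff_surj (per_periodic d) hd.
  pose f i := per v i + c i *m W i.
  have pf : nperiodic n f by move=> i; rewrite /f per_periodic pC pW.
  exists (per_of n f) => //.
  have cE i : pc (per_of n f) i = c i.
    rewrite /pc per_per_of // mulmxDl (coef_mx_perp _ hv) add0r.
    by rewrite -mulmxA coef_mxW // mulmx1.
  rewrite /phi; congr pair.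
    rewrite -[RHS]per_ofK; apply: eq_per_of => i.
    by rewrite /pv cE per_per_of // /f addrK.
  rewrite -[RHS]per_ofK; apply: eq_per_of => i.
  by rewrite /cdiff !cE -/(cdiff c i) cd.
- move=> u _; rewrite hformE /zform /= !per_per_of //; last exact: pdel.
  rewrite -hess_mx_zform //; try exact: perp_proj.
  by congr (hess_mx _ _ _ _ _ _ _); apply/funext => i; rewrite /pv subrK.
Qed.

(** The form h^perp on X. *)
Definition hperp_form (u v : 'M[R]_(n, m)) : R := hperp_mx n A B W (per u) (per v) 0 0.

(** A flag from the graph of v |-> (beta_i(v) G_i^-1)_i, where j = 0, to Z,
    where j = n: the entry d_i is free for i < j. *)
Definition Zflag (j : nat) : set Z :=
  [set z | Zperp z /\ forall i : nat, (j <= i < n)%N ->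
     per z.2 i%:Z = bt (per z.1) i%:Z *m invmx (G i%:Z)].

Lemma beta_mx_lin r a (u v : int -> 'M[R]_(r, m)) i :
  bt (fun i => a%:M *m u i + v i) i = a *: bt u i + bt v i.
Proof. by rewrite /beta_mx mul_scalar_mx !mulmxDl -!scalemxAl. Qed.

Lemma is_subspace_Zflag j : is_subspace (Zflag j).
Proof.
split.
  split; first exact: perp_per0.
  by move=> i _; rewrite per0 /beta_mx per0 !mul0mx.
move=> a u v [u1 u2] [v1 v2]; split; first exact: perp_per_lin.
move=> i ij; rewrite /= !per_linE beta_mx_lin u2 // v2 // mul_scalar_mx.
by rewrite mulmxDl -scalemxAl.
Qed.

Lemma ind_Zflag0 : ind (Zflag 0) zform = ind [set u | perp B W (per u)] hperp_form.
Proof.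
pose psi (u : 'M[R]_(n, m)) : Z := (u, per_of n (fun i => bt (per u) i *m invmx (G i))).
have pb (u : 'M[R]_(n, m)) : nperiodic n (fun i => bt (per u) i *m invmx (G i)).
  by move=> i; rewrite beta_mx_periodic ?gram_periodic //; apply: per_periodic.
apply: esym; apply: (ind_pullback (phi := psi)).
- move=> a u v; rewrite /psi; congr pair.
  rewrite -per_of_lin; apply: eq_per_of => i.
  by rewrite per_linE beta_mx_lin mulmxDl -scalemxAl.
- split; first exact: perp_per0.
  by move=> a u v; apply: perp_per_lin.
- by rewrite (sb0l zform_bilinear).
- by move=> u hu; split=> // i /andP[_ ij]; rewrite /= per_per_of.
- move=> [u d] [/= hu hd]; exists u => //; rewrite /psi; congr pair.
  rewrite -[RHS]per_ofK; apply/matrixP => i j; rewrite [LHS]mxE [RHS]mxE.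
  by rewrite hd /= ?ltn_ord.
- by move=> u hu; rewrite /zform /= per_per_of // zform_mx_hperp.
Qed.

(** The pair (0, d) with d_j = x and d_i = 0 for i <> j. *)
Definition bump_row (j : 'I_n) (x : 'rV[R]_k) : Z :=
  (0, \matrix_(i < n) (if i == j then x else 0)).

Lemma per_bump (j : 'I_n) x (i : 'I_n) :
  per (bump_row j x).2 (i : nat)%:Z = if i == j then x else 0.
Proof. by rewrite per_row rowK. Qed.

Lemma bump_lin j : linear (bump_row j).
Proof.
move=> a x y; rewrite /bump_row; congr pair; first by rewrite /= addr0 scaler0.
by apply/matrixP => i l; rewrite !mxE; case: eqP; rewrite !mxE // mulr0 addr0.
Qed.

Lemma zform_bump z (j : 'I_n) x :
  zform z (bump_row j x) =
  ((per z.2 (j : nat)%:Z *m G (j : nat)%:Z - bt (per z.1) (j : nat)%:Z) *m x^T) 0 0.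
Proof.
rewrite /zform.
have -> : per (bump_row j x).1 = (fun _ => 0) by apply/funext => i; rewrite per0.
rewrite zform_mx_0r psum0; last first.
  move=> i; rewrite !per_periodic gram_periodic // beta_mx_periodic //.
  exact: per_periodic.
rewrite big_mkord (bigD1 j) //= per_bump eqxx big1 ?addr0 // => i ij.
by rewrite per_bump (negPf ij) trmx0 mulmx0.
Qed.

Lemma ind_bump (j : 'I_n) :
  ind (range (bump_row j)) zform = ind setT (pairing (G (j : nat)%:Z)).
Proof.
apply: esym; apply: (ind_pullback (phi := bump_row j)).
- exact: bump_lin.
- exact: is_subspaceT.
- by rewrite (sb0l zform_bilinear).
- by move=> x _; exists x.
- by move=> _ [x _ <-]; exists x.
- by move=> x _; rewrite zform_bump per_bump eqxx /beta_mx per0 !mul0mx subr0.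
Qed.

Lemma is_subspace_bump j : is_subspace (range (bump_row j)).
Proof.
split.
  exists 0 => //; rewrite /bump_row; congr pair.
  by apply/matrixP => i l; rewrite !mxE; case: eqP; rewrite ?mxE.
by move=> a _ _ [x _ <-] [y _ <-]; exists (a *: x + y) => //; rewrite bump_lin.
Qed.

Lemma ind_ZflagS (j : 'I_n) :
  ind (Zflag j.+1) zform = (ind (Zflag j) zform + ind setT (pairing (G (j : nat)%:Z)))%N.
Proof.
rewrite -ind_bump; apply: ind_orth_sum.
- exact: zform_bilinear.
- exact: is_subspace_Zflag.
- exact: is_subspace_bump.
- move=> u _ [hu1 hu2] [x _ <-]; split.
    by rewrite /Zperp /= addr0.
  move=> i /andP[ji in_]; rewrite /= addr0 perD hu2 ?(ltnW ji) //.
  rewrite (per_bump _ _ (Ordinal in_)) ifN ?addr0 //.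
  by apply: contraTneq ji => <-; rewrite ltnn.
- move=> u [hu1 hu2].
  (* The excess of d_j over the value prescribed in Zflag j. *)
  pose x := per u.2 (j : nat)%:Z - bt (per u.1) (j : nat)%:Z *m invmx (G (j : nat)%:Z).
  exists (u - bump_row j x), (bump_row j x); split.
  + split; first by rewrite /Zperp /= subr0.
    move=> i /andP[ji in_]; rewrite /= subr0 perB (per_bump _ _ (Ordinal in_)).
    have [e|ne] := eqVneq (Ordinal in_) j; first by rewrite /x -e subKr.
    rewrite subr0 hu2 // in_ andbT ltn_neqAle ji andbT.
    by apply: contraNneq ne => e; apply/eqP/val_inj.
  + by exists x.
  + by rewrite subrK.
- move=> u _ [hu1 hu2] [x _ <-]; rewrite zform_bump hu2 ?leqnn ?ltn_ord //.
  by rewrite mulmxKV // subrr mul0mx mxE.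
Qed.

Lemma ind_Zflag j : (j <= n)%N ->
  ind (Zflag j) zform = (ind [set u | perp B W (per u)] hperp_form
    + \sum_(0 <= i < j) ind setT (pairing (G i%:Z)))%N.
Proof.
elim: j => [_|j IH jn]; first by rewrite big_geq // addn0 ind_Zflag0.
by rewrite (ind_ZflagS (Ordinal jn)) IH ?(ltnW jn) // big_nat_recr //= addnA.
Qed.

(** The b-th rows of v and d form the pair (v^b, d^b); see quasi_periodic_data for their
    construction from the vectors q_b. *)
Variables (v : int -> 'M[R]_(k, m)) (d : int -> 'M[R]_k) (s : 'M[R]_k).
Hypothesis pv : nperiodic n v.
Hypothesis pd : nperiodic n d.
Hypothesis hv : perp B W v.
Hypothesis h1 : forall i : nat, (0 < i <= n)%N -> d i%:Z *m G i%:Z - bt v i%:Z = 1%:M.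
Hypothesis h2 : forall (v' : int -> 'rV[R]_m) (i : nat), perp B W v' -> (0 < i <= n)%N ->
  variation_mx A B v i%:Z *m (v' i%:Z)^T = d i%:Z *m (bt v' i%:Z)^T.
Hypothesis ds : psum n d = s.
Hypothesis su : s \in unitmx.

(** The linear combinations of the k pairs (v^b, d^b). *)
Definition zcomb (y : 'rV[R]_k) : Z :=
  (per_of n (fun i => y *m v i), per_of n (fun i => y *m d i)).

Lemma per_zcomb1 y : per (zcomb y).1 = (fun i => y *m v i).
Proof. by rewrite per_per_of // => i; rewrite pv. Qed.

Lemma per_zcomb2 y : per (zcomb y).2 = (fun i => y *m d i).
Proof. by rewrite per_per_of // => i; rewrite pd. Qed.

Lemma zcomb_lin : linear zcomb.
Proof.
move=> a x y; rewrite /zcomb; congr pair.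
  by rewrite -per_of_lin; apply: eq_per_of => i; rewrite mulmxDl -scalemxAl.
by rewrite -per_of_lin; apply: eq_per_of => i; rewrite mulmxDl -scalemxAl.
Qed.

Lemma Zperp_zcomb y : Zperp (zcomb y).
Proof. by rewrite /Zperp /= per_zcomb1 => i; rewrite -mulmxA hv mulmx0. Qed.

Lemma psum_zcomb y : psum n (per (zcomb y).2) = y *m s.
Proof. by rewrite per_zcomb2 psum_mull ds. Qed.

Lemma zform_zcomb y z : Zperp z ->
  zform (zcomb y) z = (y *m (psum n (per z.2))^T) 0 0.
Proof.
move=> hz; rewrite /zform per_zcomb1 per_zcomb2 zform_mx_mull zform_mx_trajectory //.
  by rewrite psum_tr.
by move=> i i1; apply: h2.
Qed.

Lemma is_subspace_zcomb : is_subspace (range zcomb).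
Proof.
split.
  exists 0 => //; rewrite /zcomb; congr pair;
    by apply/row_matrixP => i; rewrite rowK mul0mx row0.
by move=> a _ _ [x _ <-] [y _ <-]; exists (a *: x + y) => //; rewrite zcomb_lin.
Qed.

Lemma ind_zcomb : ind (range zcomb) zform = ind setT (pairing s).
Proof.
apply: esym; apply: (ind_pullback (phi := zcomb)).
- exact: zcomb_lin.
- exact: is_subspaceT.
- by rewrite (sb0l zform_bilinear).
- by move=> x _; exists x.
- by move=> _ [x _ <-]; exists x.
- move=> x _; rewrite zform_zcomb ?psum_zcomb; last exact: Zperp_zcomb.
  by rewrite pairing_tr /pairing trmx_mul mulmxA.
Qed.

(** Z is the Q-orthogonal sum of K and the span of the pairs (v^b, d^b). *)
Lemma index_identity :
  (ind [set u | perp B W (per u)] hperp_form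
    + \sum_(0 <= i < n) ind setT (pairing (G i%:Z))
  = ind setT (hform (n := n) A B) + ind setT (pairing s))%N.
Proof.
rewrite -ind_Zflag // ind_hform -ind_zcomb; apply: ind_orth_sum.
- exact: zform_bilinear.
- exact: is_subspace_Zsum0.
- exact: is_subspace_zcomb.
- move=> u _ [hu1 hu2] [y _ <-]; split.
    by rewrite -[u]scale1r; apply: perp_per_lin => //; apply: Zperp_zcomb.
  by move=> i /andP[]; rewrite leqNgt => /negPf ->.
- move=> u [hu _]; pose y := psum n (per u.2) *m invmx s.
  have uE : u - zcomb y = (-1) *: zcomb y + u by rewrite scaleN1r addrC.
  exists (u - zcomb y), (zcomb y); split; [|by exists y|by rewrite subrK].
  rewrite uE; split; first by apply: perp_per_lin => //; apply: Zperp_zcomb.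
  by rewrite psum_per_lin psum_zcomb mulmxKV // scaleN1r addNr.
- move=> u _ [hu1 hu2] [y _ <-].
  by rewrite (sbC zform_bilinear) zform_zcomb // hu2 trmx0 mulmx0 mxE.
Qed.

End IndexIdentity.

(** * The symplectic form and the vectors q *)

Section Symplectic.
Variables (R : realType) (m n k : nat) (A B : int -> 'M[R]_m).
Hypothesis n0 : (0 < n)%N.
Hypothesis AT : forall i, (A i)^T = A i.
Hypothesis pB : nperiodic n B.
Hypothesis Bu : forall i, B i \in unitmx.

(** The matrix of omega; see omegaE. *)
Definition Omega : 'M[R]_(m + m) := block_mx 0 (B 0) (- (B 0)^T) 0.

Lemma Omega_tr : Omega^T = - Omega.
Proof.
by rewrite /Omega tr_block_mx opp_block_mx !trmx0 !oppr0 linearN /= trmxK opprK.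
Qed.

Lemma mulmx_tr_entry r r' p (X : 'M[R]_(r, p)) (Y : 'M[R]_(r', p)) a b :
  (X *m Y^T) a b = (row a X *m (row b Y)^T) 0 0.
Proof.
rewrite [LHS]mxE [RHS]mxE; apply: eq_bigr => j _.
by congr (_ * _); [rewrite [RHS]mxE | rewrite !mxE].
Qed.

Lemma row_Omega r r' (a b : 'M[R]_(r, m)) (a' b' : 'M[R]_(r', m)) :
  row_mx a b *m Omega *m (row_mx a' b')^T = a *m B 0 *m b'^T - b *m (B 0)^T *m a'^T.
Proof.
rewrite /Omega mul_row_block !mulmx0 add0r addr0 tr_row_mx mul_row_col.
by rewrite mulmxN mulNmx addrC.
Qed.

Lemma omegaE p p' : omega B p p' = (p *m Omega *m p'^T) 0 0.
Proof.
rewrite -[in RHS](hsubmxK p) -[in RHS](hsubmxK p') row_Omega /omega.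
by rewrite [pairing _ (lsubmx p') _]pairing_tr /pairing !mxE.
Qed.

(** The symplectic product evaluated at the index i. *)
Definition omega_mx r r' (i : int) (u : int -> 'M[R]_(r, m))
    (v : int -> 'M[R]_(r', m)) : 'M[R]_(r, r') :=
  u i *m B i *m (v (i + 1))^T - u (i + 1) *m (B i)^T *m (v i)^T.

(** Conservation of omega along trajectories. *)
Lemma omega_mx_step r r' (u : int -> 'M[R]_(r, m)) (v : int -> 'M[R]_(r', m)) i :
  variation_mx A B u i = 0 -> variation_mx A B v i = 0 ->
  omega_mx i u v = omega_mx (i - 1) u v.
Proof.
have next p (x : int -> 'M[R]_(p, m)) : variation_mx A B x i = 0 ->
    x (i + 1) *m (B i)^T = x i *m A i - x (i - 1) *m B (i - 1).
  by move/eqP; rewrite /variation_mx subr_eq0 => /eqP.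
move=> /next hu /next hv; rewrite /omega_mx hu subrK.
have -> : u i *m B i *m (v (i + 1))^T = u i *m (v (i + 1) *m (B i)^T)^T.
  by rewrite trmx_mul trmxK mulmxA.
rewrite hv linearB /= mulmxBr mulmxBl !trmx_mul AT !mulmxA.
by rewrite opprB addrC addrA subrK.
Qed.

(** The trajectory with initial data p, with its values at negative indices
    replaced by those at the opposite ones: only i >= 0 matters. *)
Definition orbit r (p : 'M[R]_(r, m + m)) (i : int) : 'M[R]_(r, m) :=
  lsubmx (p *m poincare `|i|%N A B).

Lemma poincareS j : poincare j.+1 A B = poincare j A B *m step A B j.+1%:Z.
Proof. by rewrite /poincare big_nat_recr. Qed.

Lemma orbit_next r (p : 'M[R]_(r, m + m)) (j : nat) :
  orbit p (j%:Z + 1) = rsubmx (p *m poincare j A B).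
Proof.
rewrite /orbit -PoszD addn1 absz_nat poincareS mulmxA -[X in X *m step _ _ _]hsubmxK.
by rewrite /step mul_row_block mulmx0 add0r mulmx1 row_mxKl.
Qed.

Lemma orbitE r (p : 'M[R]_(r, m + m)) (j : nat) :
  p *m poincare j A B = row_mx (orbit p j%:Z) (orbit p (j%:Z + 1)).
Proof. by rewrite orbit_next /orbit absz_nat hsubmxK. Qed.

Lemma orbit0 r (p : 'M[R]_(r, m + m)) : p = row_mx (orbit p 0) (orbit p 1).
Proof. by rewrite -[LHS]mulmx1 -(orbitE p 0) /poincare big_geq. Qed.

Lemma variation_orbit r (p : 'M[R]_(r, m + m)) (j : nat) :
  variation_mx A B (orbit p) j.+1%:Z = 0.
Proof.
have e := orbit_next p j.+1.
have j1 : j.+1%:Z - 1 = j%:Z by rewrite -addn1 PoszD addrK.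
have j2 : j.+1%:Z = j%:Z + 1 by rewrite -PoszD addn1.
rewrite /variation_mx e poincareS mulmxA orbitE /step mul_row_block row_mxKr j1 -j2.
rewrite mulmxN mulmxDl mulNmx -!mulmxA mulVmx ?unitmx_tr // !mulmx1.
by rewrite [X in _ - X]addrC subrr.
Qed.

Lemma omega_mx_orbit r r' (p : 'M[R]_(r, m + m)) (v : int -> 'M[R]_(r', m)) (j : nat) :
  (forall i, variation_mx A B v i = 0) ->
  omega_mx j%:Z v (orbit p) = row_mx (v 0) (v 1) *m Omega *m p^T.
Proof.
move=> tv; elim: j => [|j IH]; first by rewrite [p in RHS]orbit0 row_Omega.
by rewrite omega_mx_step ?variation_orbit // -addn1 PoszD addrK.
Qed.

Variables (w : 'I_k -> int -> 'rV[R]_m) (q : 'I_k -> 'rV[R]_(m + m)).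
Hypothesis isoV : forall v v' : 'rV[R]_(m + m),
      (v <= kerV n A B)%MS -> (v' <= kerV n A B)%MS -> omega B v v' = 0.
Hypothesis rkN : \rank (kerN n A B) = (2 * k)%N.
Hypothesis wV : basis_of_V n A B w.
Hypothesis GmxU : forall i, Gmx B w i \in unitmx.
Hypothesis qD : dual_basis n A B w q.

(** The matrix W_i. *)
Definition Wm (i : int) : 'M[R]_(k, m) := \matrix_a w a i.
(** The initial data of the w^a, a basis of V. *)
Definition Wini : 'M[R]_(k, m + m) := \matrix_a init (w a).
(** The vectors q_a as rows. *)
Definition Qm : 'M[R]_(k, m + m) := \matrix_a q a.
(** The matrix s. *)
Definition sgram : 'M[R]_k := \matrix_(a, b) bform n A B (q a) (q b).
Local Notation P := (poincare n A B).

Lemma WiniE : Wini = row_mx (Wm 0) (Wm 1).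
Proof.
by apply/row_matrixP => a; rewrite row_row_mx !rowK.
Qed.

Lemma Omega_entry r r' (X : 'M[R]_(r, m + m)) (Y : 'M[R]_(r', m + m)) a b :
  (X *m Omega *m Y^T) a b = omega B (row a X) (row b Y).
Proof. by rewrite omegaE -row_mul mulmx_tr_entry. Qed.

Lemma pWm : nperiodic n Wm.
Proof. by move=> i; apply/row_matrixP => a; rewrite !rowK; case: wV. Qed.

Lemma tWm i : variation_mx A B Wm i = 0.
Proof.
apply/row_matrixP => a; rewrite /variation_mx !linearB /= !row_mul !rowK row0.
by case: wV => /(_ a i).
Qed.

Lemma gramE i : gram B Wm i = Gmx B w i.
Proof.
apply/matrixP => a b; rewrite [RHS]mxE /pairing /gram.
by rewrite [LHS]mulmx_tr_entry !row_mul /Wm !rowK.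
Qed.

Lemma gram_unit i : gram B Wm i \in unitmx. Proof. by rewrite gramE. Qed.

Lemma Wini_isotropic : Wini *m Omega *m Wini^T = 0.
Proof.
case: wV => _ _ _ /eqmxP wv; apply/matrixP => a b; rewrite Omega_entry mxE.
by apply: isoV; rewrite -wv row_sub.
Qed.

Lemma Wini_Qm : Wini *m Omega *m Qm^T = 1%:M.
Proof.
case: qD => _ wq _; apply/matrixP => a b; rewrite Omega_entry !rowK mxE wq.
by [].
Qed.

Lemma Qm_Wini : Qm *m Omega *m Wini^T = - 1%:M.
Proof.
apply: trmx_inj; rewrite !trmx_mul trmxK Omega_tr mulNmx mulmxN mulmxA Wini_Qm.
by rewrite linearN /= trmx1.
Qed.

Lemma sgramE : sgram = Qm *m (P - 1) *m Omega *m Qm^T.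
Proof.
by apply/matrixP => a b; rewrite Omega_entry row_mul !rowK mxE.
Qed.

(** The difference G_i - G_i^T is omega on V, which vanishes. *)
Lemma gram_tr i : (gram B Wm i)^T = gram B Wm i.
Proof.
have omgW : forall j, omega_mx j Wm Wm = omega_mx (j - 1) Wm Wm.
  by move=> j; apply: omega_mx_step; apply: tWm.
have omgG j : omega_mx j Wm Wm = gram B Wm j - (gram B Wm j)^T.
  by rewrite /omega_mx /gram !trmx_mul trmxK mulmxA.
have omg0 : omega_mx 0 Wm Wm = 0 by rewrite -[RHS]Wini_isotropic WiniE row_Omega.
have omgn (j : nat) : omega_mx j%:Z Wm Wm = 0.
  by elim: j => [//|j IH]; rewrite omgW -addn1 PoszD addrK.
have pg : nperiodic n (fun j => omega_mx j Wm Wm).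
  by move=> j; rewrite !omgG (gram_periodic pB pWm).
apply/eqP; rewrite eq_sym -subr_eq0 -omgG.
by rewrite (periodic_mod i n0 pg) omgn.
Qed.

Lemma Wini_fixed : Wini *m (P - 1) = 0.
Proof.
apply/sub_kermxP; case: wV => _ _ _ /eqmxP wv.
by rewrite -/(kerV n A B) -wv.
Qed.

Lemma Qm_N : (Qm <= kerN n A B)%MS.
Proof. by case: qD => qN _ _; apply/row_subP => a; rewrite rowK. Qed.

Lemma Wini_N : (Wini <= kerN n A B)%MS.
Proof.
(* For m = 0 the exponent 2m vanishes, but so does the whole space. *)
have [m0|m0] := posnP m.
  suff -> : Wini = 0 by apply: sub0mx.
  by apply/matrixP => a [b bm]; exfalso; rewrite m0 in bm.
apply/sub_kermxP; rewrite -(prednK (n := (2 * m))) ?muln_gt0 //.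
by rewrite exprS mulmxA Wini_fixed mul0mx.
Qed.

(** P - I maps into the omega-orthogonal complement of V, as P preserves omega
    and fixes V. *)
Lemma moved_orth_Wini r (p : 'M[R]_(r, m + m)) : p *m (P - 1) *m Omega *m Wini^T = 0.
Proof.
suff h : Wini *m Omega *m (p *m (P - 1))^T = 0.
  apply: trmx_inj; rewrite !trmx_mul trmxK Omega_tr mulNmx mulmxN mulmxA.
  by rewrite -trmx_mul h oppr0 trmx0.
rewrite mulmxBr mulmx1 linearB /= mulmxBr; apply/eqP; rewrite subr_eq0; apply/eqP.
have Wn : Wini = row_mx (Wm n%:Z) (Wm (n%:Z + 1)).
  by rewrite WiniE (periodicN pWm) [n%:Z + 1]addrC pWm.
have := omega_mx_orbit p n tWm; rewrite -WiniE => <-.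
by rewrite orbitE Wn row_Omega /omega_mx (periodicN pB).
Qed.

Lemma WQ_free (x y : 'rV[R]_k) : x *m Wini + y *m Qm = 0 -> x = 0 /\ y = 0.
Proof.
move=> h; have y0 : y = 0.
  have := congr1 (fun z => z *m Omega *m Wini^T) h.
  rewrite !mulmxDl !mul0mx -!mulmxA !(mulmxA _ Omega) Wini_isotropic Qm_Wini.
  rewrite mulmx0 add0r mulmxN mulmx1.
  by move/eqP; rewrite oppr_eq0 => /eqP.
split=> //; have := congr1 (fun z => z *m Omega *m Qm^T) h.
by rewrite y0 /= !mul0mx addr0 -!mulmxA (mulmxA Wini) Wini_Qm mulmx1.
Qed.

(** The w^a and q_a are 2k independent vectors of N, hence a basis. *)
Lemma N_span r (p : 'M[R]_(r, m + m)) : (p <= kerN n A B)%MS ->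
  exists x y, p = x *m Wini + y *m Qm.
Proof.
move=> pN; pose C := col_mx Wini Qm.
have CN : (C <= kerN n A B)%MS.
  by rewrite col_mx_sub Wini_N Qm_N.
have Cf : row_free C.
  rewrite -kermx_eq0; apply/rowV0P => z /sub_kermxP.
  rewrite -[z]hsubmxK mul_row_col => /WQ_free[-> ->].
  by rewrite row_mx0.
have NC : (kerN n A B <= C)%MS.
  by rewrite -(mxrank_leqif_sup CN).2 rkN (eqP Cf) mul2n addnn.
have /submxP[D ->] := submx_trans pN NC.
by exists (lsubmx D), (rsubmx D); rewrite -mul_row_col hsubmxK.
Qed.

(** (P - I) q_a lies in N and is orthogonal to V, so it lies in V; its coordinates
    are its products with the q_b. *)
Lemma Qm_moved : Qm *m (P - 1) = sgram *m Wini.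
Proof.
have QN : (Qm *m (P - 1) <= kerN n A B)%MS.
  apply/sub_kermxP; rewrite -mulmxA.
  have -> : (P - 1) *m (P - 1) ^+ (2 * m) = (P - 1) ^+ (2 * m) *m (P - 1).
    by apply: commrX.
  by rewrite mulmxA (sub_kermxP Qm_N) mul0mx.
have [x [y e]] := N_span QN.
have y0 : y = 0.
  have := moved_orth_Wini Qm.
  rewrite e !mulmxDl -!mulmxA !(mulmxA _ Omega) Wini_isotropic Qm_Wini.
  rewrite mulmx0 add0r mulmxN mulmx1.
  by move/eqP; rewrite oppr_eq0 => /eqP.
have := sgramE; rewrite e y0 mul0mx addr0 -!mulmxA (mulmxA Wini) Wini_Qm mulmx1.
by move=> ->.
Qed.

Lemma Qm_P : Qm *m P = Qm + sgram *m Wini.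
Proof. by rewrite -Qm_moved mulmxBr mulmx1 addrC subrK. Qed.

Lemma sgram_unit : sgram \in unitmx.
Proof.
rewrite -row_free_unit -kermx_eq0; apply/rowV0P => y /sub_kermxP ys.
have yV : (y *m Qm <= kerV n A B)%MS.
  by apply/sub_kermxP; rewrite -mulmxA Qm_moved mulmxA ys mul0mx.
case: wV => _ _ _ /eqmxP wv; move: yV; rewrite -wv => /submxP[x].
rewrite -/Wini => h.
have /WQ_free[_ /eqP] : (- x) *m Wini + y *m Qm = 0 by rewrite h mulNmx addNr.
by move/eqP.
Qed.

Lemma Wini_coord (x y : 'rV[R]_k) : Wini *m Omega *m (x *m Wini + y *m Qm)^T = y^T.
Proof.
rewrite linearD /= !trmx_mul mulmxDr !mulmxA Wini_isotropic mul0mx add0r.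
by rewrite Wini_Qm mul1mx.
Qed.

Lemma bform_coord (x y : 'rV[R]_k) :
  bform n A B (x *m Wini + y *m Qm) (x *m Wini + y *m Qm) = pairing sgram y y.
Proof.
rewrite /bform omegaE /pairing mulmxDl -!(mulmxA _ _ (P - 1)) Wini_fixed.
rewrite mulmx0 add0r Qm_moved.
by rewrite mulmxA -!(mulmxA (y *m sgram)) Wini_coord.
Qed.

(** The form b factors through the coordinates along q, where its matrix is s. *)
Lemma ind_bform :
  ind [set v | (v <= kerN n A B)%MS] (bform n A B) = ind setT (pairing sgram).
Proof.
pose phi (p : 'rV[R]_(m + m)) : 'rV[R]_k := p *m (Wini *m Omega)^T.
have phiE x y : phi (x *m Wini + y *m Qm) = y.
  by apply: trmx_inj; rewrite /phi trmx_mul trmxK Wini_coord.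
apply: (ind_pullback (phi := phi)) => //.
- by move=> a u v; rewrite /phi mulmxDl -scalemxAl.
- split; first by rewrite /= sub0mx.
  by move=> a u v hu hv; rewrite /= addmx_sub ?scalemx_sub.
- by rewrite /pairing !mul0mx mxE.
- move=> y _; exists (0 *m Wini + y *m Qm); last exact: phiE.
  by rewrite mul0mx add0r /= mulmx_sub // Qm_N.
- by move=> p /= /N_span[x [y ->]]; rewrite phiE bform_coord.
Qed.

Local Notation U := (orbit Qm).
Local Notation W := Wm.
Local Notation C := (coef_mx B Wm).

Lemma Qm_orbit_n : U n%:Z = U 0 + sgram *m W 0 /\ U (n%:Z + 1) = U 1 + sgram *m W 1.
Proof.
apply: eq_row_mx; rewrite -orbitE Qm_P {1}[Qm in LHS]orbit0 WiniE.
by rewrite mul_mx_row add_row_mx.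
Qed.

(* Components of the trajectories U along W and in E_i^perp. *)
Let cU (i : int) : 'M[R]_k := U i *m C i.
Let vU (i : int) : 'M[R]_(k, m) := U i - cU i *m W i.

(** The trajectories U issued from the q_b are periodic up to sgram *m W, so their
    components v in E_i^perp and the differences of their coordinates along W
    are periodic. *)
Lemma quasi_periodic_data : exists (v : int -> 'M[R]_(k, m)) (d : int -> 'M[R]_k),
  [/\ nperiodic n v, nperiodic n d, perp B W v, psum n d = sgram &
  (forall i : nat, (0 < i <= n)%N ->
     d i%:Z *m gram B W i%:Z - beta_mx B W v i%:Z = 1%:M) /\
  forall (v' : int -> 'rV[R]_m) (i : nat), perp B W v' -> (0 < i <= n)%N ->
    variation_mx A B v i%:Z *m (v' i%:Z)^T = d i%:Z *m (beta_mx B W v' i%:Z)^T].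
Proof.
have [Un Un1] := Qm_orbit_n.
have pC := coef_mx_periodic pB pWm.
have CW i : W i *m C i = 1%:M by apply: coef_mxW; [apply: gram_tr | apply: gram_unit].
have [Cn Cn1] : C n%:Z = C 0 /\ C (n%:Z + 1) = C 1.
  by rewrite (periodicN pC) [_ + 1]addrC pC.
have [Wn Wn1] : W n%:Z = W 0 /\ W (n%:Z + 1) = W 1.
  by rewrite (periodicN pWm) [_ + 1]addrC pWm.
have cn : cU n%:Z = cU 0 + sgram by rewrite /cU Un Cn mulmxDl -mulmxA CW mulmx1.
have cn1 : cU (n%:Z + 1) = cU 1 + sgram.
  by rewrite /cU Un1 Cn1 mulmxDl -mulmxA CW mulmx1.
have vn : vU n%:Z = vU 0 by rewrite /vU cn Un Wn mulmxDl opprD addrACA subrr addr0.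
have vn1 : vU (n%:Z + 1) = vU 1.
  by rewrite /vU cn1 Un1 Wn1 mulmxDl opprD addrACA subrr addr0.
(* The equations at 1, ..., n involve only the indices 0, ..., n + 1, where the
   periodic extensions v and d agree with the trajectories (vE and dE). *)
pose v := pextend n (fun j => vU j%:Z); pose d := pextend n (fun j => cdiff cU j%:Z).
have pv : nperiodic n v by apply: pextend_periodic.
have pd : nperiodic n d by apply: pextend_periodic.
have vE (j : nat) : (j <= n.+1)%N -> v j%:Z = vU j%:Z.
  rewrite leq_eqVlt => /orP[/eqP ->|]; last by rewrite ltnS; apply: pextend_le.
  rewrite -addn1 PoszD addrC pv addrC vn1.
  by apply: (pextend_le (j := 1)).
have dE (j : nat) : (j <= n)%N -> d j%:Z = cdiff cU j%:Z.
  by apply: pextend_le; rewrite /cdiff cn1 cn opprD addrACA subrr addr0 add0r.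
have hvU : perp B W vU by apply: perp_proj; [apply: gram_tr | apply: gram_unit].
have hv : perp B W v.
  move=> i; have pF : nperiodic n (fun i => W (i - 1) *m B (i - 1)).
    by move=> j; rewrite (addrAC j) pWm pB.
  rewrite (periodic_mod i n0 pF) (periodic_mod i n0 pv) vE ?hvU //.
  by rewrite ltnW // ltnS ltnW // mod_lt.
exists v, d; split=> //.
- rewrite psum0 // big_nat (eq_bigr (fun j : nat => cU j.+1%:Z - cU j%:Z)); last first.
    by move=> j /andP[_ jn]; rewrite dE ?(ltnW jn) // /cdiff -PoszD addn1.
  by rewrite -big_nat (telescope_sumr (fun j : nat => cU j%:Z)) // cn addrC addKr.
split=> [i /andP[i0 i_n]|v' i hv' /andP[i0 i_n]].
- (* Conservation of omega between W and U, with value Wini_Qm. *)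
  rewrite dE // /beta_mx vE ?(leqW i_n) // -/(beta_mx B W vU i%:Z).
  have UE j : U j = vU j + cU j *m W j by rewrite /vU subrK.
  have := omega_mx_orbit Qm i tWm; rewrite -WiniE Wini_Qm => /(congr1 trmx).
  rewrite trmx1 => <-; rewrite /omega_mx linearB /= !trmx_mul !trmxK !mulmxA.
  have -> : U (i%:Z + 1) *m (B i%:Z)^T *m (W i%:Z)^T = cU (i%:Z + 1) *m gram B W i%:Z.
    have -> : gram B W i%:Z = W (i%:Z + 1) *m (W i%:Z *m B i%:Z)^T.
      by rewrite -[LHS]gram_tr /gram [in LHS]trmx_mul trmxK.
    rewrite UE -mulmxA -trmx_mul mulmxDl mulmxA.
    by have := hvU (i%:Z + 1); rewrite addrK => ->; rewrite add0r.
  rewrite [U i%:Z]UE /cdiff /beta_mx /gram.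
  move: (vU i%:Z) (cU i%:Z) (cU (i%:Z + 1)) => x c0 c1.
  by rewrite !mulmxDl !mulNmx !mulmxA opprD addrA [LHS]addrAC.
- (* The component of the equation of motion of U along v'. *)
  have i1 : i%:Z - 1 = i.-1%:Z by rewrite -[in LHS](prednK i0) -addn1 PoszD addrK.
  have i2 : i%:Z + 1 = i.+1%:Z by rewrite -PoszD addn1.
  have -> : variation_mx A B v i%:Z = variation_mx A B vU i%:Z.
    rewrite /variation_mx i1 i2 !vE // ?(leqW i_n) //.
    by rewrite (leq_trans (leq_pred _)) // leqW.
  have tU : variation_mx A B U i%:Z = 0 by rewrite -(prednK i0) variation_orbit.
  have tW' : forall j, variation_mx A B W j = 0 by apply: tWm.
  have : variation_mx A B vU i%:Z + variation_mx A B (fun j => cU j *m W j) i%:Z = 0.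
    rewrite -variation_mxD -tU; congr (variation_mx _ _ _ _); apply/funext => j.
    by rewrite /vU subrK.
  move/eqP; rewrite addr_eq0 => /eqP ->.
  rewrite (variation_mxW tW') opprB mulmxBl -[X in _ - X]mulmxA.
  have -> : W (i%:Z - 1) *m B (i%:Z - 1) *m (v' i%:Z)^T = 0.
    by apply: trmx_inj; rewrite trmx_mul trmxK hv' trmx0.
  by rewrite mulmx0 subr0 dE // /beta_mx !trmx_mul trmxK !mulmxA.
Qed.

End Symplectic.

(** * Comparison of sigma and sigma^perp *)

Section Sign.
Variable R : realType.

Lemma prod_period0 n (F : int -> R) : (0 < n)%N -> nperiodic n F ->
  \prod_(1 <= i < n.+1) F i%:Z = \prod_(0 <= i < n) F i%:Z.
Proof.
case: n => // n _ pF; rewrite big_nat_recr //= big_add1 /= [RHS]big_nat_recl //= mulrC.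
by congr (_ * _); rewrite -[in RHS](pF 0) add0r.
Qed.

Lemma prod_shift n (F : int -> R) : (0 < n)%N -> nperiodic n F ->
  \prod_(1 <= i < n.+1) F (i%:Z + 1) = \prod_(1 <= i < n.+1) F i%:Z.
Proof.
move=> n0 pF; rewrite (prod_period0 n0 (periodic_shift 1 pF)) [RHS]big_add1.
by apply: eq_bigr => i _; rewrite -PoszD addn1.
Qed.

Lemma adapted_basis_unit d k (e : 'M[R]_(d, d + k)) (W : 'M[R]_(k, d + k))
    (C : 'M[R]_(d + k, k)) :
  row_free e -> e *m C = 0 -> W *m C = 1%:M -> col_mx e W \in unitmx.
Proof.
move=> ef eC WC; rewrite -row_free_unit -kermx_eq0; apply/rowV0P => x /sub_kermxP.
rewrite -[x]hsubmxK mul_row_col => h.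
have r0 : rsubmx x = 0.
  have := congr1 (mulmx^~ C) h; rewrite mulmxDl -!mulmxA eC WC mulmx0 add0r mulmx1.
  by rewrite mul0mx.
move: h; rewrite r0 mul0mx addr0 => h.
suff -> : lsubmx x = 0 by rewrite row_mx0.
by apply/(row_free_inj ef); rewrite mul0mx.
Qed.

(** In the bases (e_i, W_i) the matrix of B_i is block triangular, since
    <B_i w_i^a, u> = 0 on E_{i+1}^perp. *)
Lemma sigma_split_add d k n (B : int -> 'M[R]_(d + k)) (W : int -> 'M[R]_(k, d + k))
    (e : int -> 'M[R]_(d, d + k)) : (0 < n)%N ->
  nperiodic n e -> nperiodic n W -> (forall i, (gram B W i)^T = gram B W i) ->
  (forall i, gram B W i \in unitmx) -> (forall i, row_free (e i)) -> perp B W e ->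
  sigma n B = sigma_perp n B e * \prod_(1 <= i < n.+1) Num.sg (\det (gram B W i%:Z)).
Proof.
move=> n0 pe pW gram_tr gram_unit ef pe0.
pose T i := col_mx (e i) (W i).
have Tu i : T i \in unitmx.
  apply: (@adapted_basis_unit _ _ _ _ (coef_mx B W i)) => //.
    exact: coef_mx_perp.
  exact: coef_mxW.
have pT : nperiodic n (fun i => \det (T i)) by move=> i; rewrite /T pe pW.
have blk i : \det (T i) * \det (B i) * \det (T (i + 1))
    = \det (Bperp B e i) * \det (gram B W i).
  rewrite -(det_tr (T (i + 1))) -!det_mulmx /T mul_col_mx tr_col_mx mul_col_row.
  have -> : W i *m B i *m (e (i + 1))^T = 0.
    by apply: trmx_inj; rewrite trmx_mul trmxK trmx0; have := pe0 (i + 1); rewrite addrK.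
  by rewrite det_ublock.
pose p := \prod_(1 <= i < n.+1) \det (T i%:Z).
have p0 : p != 0.
  rewrite /p; elim/big_rec: _ => [|i x _ x0]; first exact: oner_neq0.
  by rewrite mulf_neq0 //; have := Tu i%:Z; rewrite unitmxE unitfE.
have E : p * (\prod_(1 <= i < n.+1) \det (B i%:Z)) * p
    = (\prod_(1 <= i < n.+1) \det (Bperp B e i%:Z))
      * \prod_(1 <= i < n.+1) \det (gram B W i%:Z).
  rewrite -{2}[p](prod_shift n0 pT) -!big_split /=.
  by apply: eq_bigr => i _; rewrite blk.
rewrite /sigma /sigma_perp -(sgr_sqrMl _ p0) E sgrM; congr (_ * _).
by rewrite (big_morph Num.sg (@sgrM R) (@sgr1 R)).
Qed.

Lemma sigma_split d k m n (B : int -> 'M[R]_m) (W : int -> 'M[R]_(k, m))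
    (e : int -> 'M[R]_(d, m)) : (d + k)%N = m -> (0 < n)%N ->
  nperiodic n e -> nperiodic n W -> (forall i, (gram B W i)^T = gram B W i) ->
  (forall i, gram B W i \in unitmx) -> (forall i, row_free (e i)) -> perp B W e ->
  sigma n B = sigma_perp n B e * \prod_(1 <= i < n.+1) Num.sg (\det (gram B W i%:Z)).
Proof. by move=> dkm; case: m / dkm B W e => B W e; apply: sigma_split_add. Qed.

End Sign.

(** * Symmetry of A and periodicity of B *)

Lemma open_setX (S T : topologicalType) (U : set S) (V : set T) :
  open U -> open V -> open (U `*` V).
Proof.
move=> oU oV; rewrite openE => -[a b] [/= Ua Vb].
by exists (U, V) => //=; split; apply: open_nbhs_nbhs.
Qed.

Section Hessian.
Variables (R : realType) (m n : nat) (M : manifold R m) (L : M -> M -> R)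
  (x : int -> M) (c : int -> chart R m M).
Hypothesis CL : discrete_lagrangian L.
Hypothesis px : nperiodic n x.
Hypothesis cx : charts_along n x c.

Lemma charts_periodic : nperiodic n c.
Proof. by move=> i; case: (cx i). Qed.

Lemma hessA_tr i : (hessA L x c i)^T = hessA L x c i.
Proof.
apply/matrixP => j l; rewrite !mxE.
have S a u v : 'D_v ('D_u (in_charts L (c a) (c (a + 1))))
      (cmap (c a) (x a), cmap (c (a + 1)) (x (a + 1)))
    = 'D_u ('D_v (in_charts L (c a) (c (a + 1))))
      (cmap (c a) (x a), cmap (c (a + 1)) (x (a + 1))).
  have [a1 d1 _] := cx a; have [a2 d2 _] := cx (a + 1).
  apply: (@schwarz _ _ _ _ _ _
    ((cmap (c a) @` cdom (c a)) `*` (cmap (c (a + 1)) @` cdom (c (a + 1))))).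
  - by apply: open_setX; apply: cimg_open.
  - by split; [exists (x a) | exists (x (a + 1))].
  - exact: CL.
exact: (f_equal2 +%R (S (i - 1) (0, delta_mx 0 j) (0, delta_mx 0 l))
                     (S i (delta_mx 0 j, 0) (delta_mx 0 l, 0))).
Qed.

Lemma hessB_periodic : nperiodic n (hessB L x c).
Proof.
by move=> i; rewrite /hessB (addrAC i) !charts_periodic !px.
Qed.

End Hessian.

(** * The forms and subspaces of the theorem in matrix form *)

Section Bridge.
Variables (R : realType) (m n k : nat) (A B : int -> 'M[R]_m)
  (w : 'I_k -> int -> 'rV[R]_m).

Lemma sub_EperpE r (u : 'M[R]_(r, m)) i :
  (u <= Eperp B w i)%MS <-> u *m (Wm w (i - 1) *m B (i - 1))^T = 0.
Proof.
have -> : Wm w (i - 1) *m B (i - 1) = \matrix_(a < k) (w a (i - 1) *m B (i - 1)).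
  by apply/row_matrixP => a; rewrite row_mul !rowK.
by split=> [/sub_kermxP|h]; last exact/sub_kermxP.
Qed.

Lemma Xperp_perp : Xperp B w = [set u : 'M[R]_(n, m) | perp B (Wm w) (per u)].
Proof.
by apply/seteqP; split=> u h i; apply/sub_EperpE; apply: h.
Qed.

Lemma beta_mxE (u : int -> 'rV[R]_m) i a :
  beta_mx B (Wm w) u i 0 a = pairing (B i) (u i) (w a (i + 1)).
Proof.
rewrite /beta_mx /pairing [LHS]mulmx_tr_entry rowK.
by congr ((_ *m _) 0 0); apply/rowP => j; rewrite [LHS]mxE.
Qed.

Lemma hperpE : hperp (n := n) A B w = hperp_form (n := n) A B (Wm w).
Proof.
apply/funext => u; apply/funext => v.
rewrite /hperp /hperp_form /hperp_mx hformE [RHS]mxE; congr (_ + _).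
rewrite [RHS]mxE; congr (- _); rewrite /psum summxE; apply: eq_bigr => i _.
rewrite mxE exchange_big /=; apply: eq_bigr => b _.
rewrite [X in _ = X * _]mxE mulr_suml; apply: eq_bigr => a _.
by rewrite -gramE [X in _ = _ * X]mxE !beta_mxE [X in X * _ = _]mulrC.
Qed.

End Bridge.

Theorem corollary3p5 (R : realType) (m n k : nat) (M : manifold R m)
    (L : M -> M -> R) (x : int -> M) (c : int -> chart R m M)
    (w : 'I_k -> int -> 'rV[R]_m) (q : 'I_k -> 'rV[R]_(m + m))
    (e : int -> 'M[R]_(m - k, m)) :
  let A := hessA L x c in
  let B := hessB L x c in
  let V := kerV n A B in
  let N := kerN n A B in
  (0 < n)%N ->
  discrete_lagrangian L ->
  trajectory L x ->
  (forall i, x (i + n%:Z) = x i) ->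
  charts_along n x c ->
  (forall i, B i \in unitmx) ->
  (forall v v' : 'rV[R]_(m + m),
      (v <= V)%MS -> (v' <= V)%MS -> omega B v v' = 0) ->
  \rank V = k ->
  \rank N = (2 * k)%N ->
  basis_of_V n A B w ->
  (forall i, Gmx B w i \in unitmx) ->
  Gbar n B w \in unitmx ->
  dual_basis n A B w q ->
  Aperp n A B w q \in unitmx ->
  perp_bases n B w e ->
  sigma n B * (-1) ^+ ind setT (hform (n := n) A B)
  = sigma_perp n B e
    * (-1) ^+ (ind (Xperp B w) (hperp (n := n) A B w)
               + ind [set v | (v <= N)%MS] (bform n A B)).
Proof.
move=> A B V N n0 CL _ px cx Bu isoV _ rkN wV GuW _ qD _ eP.
have AT : forall i, (A i)^T = A i := hessA_tr CL cx.
have pB : nperiodic n B := hessB_periodic L px cx.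
have pW : nperiodic n (Wm w) := pWm wV.
have tW : forall i, variation_mx A B (Wm w) i = 0 := tWm wV.
have gram_unit i : gram B (Wm w) i \in unitmx by rewrite gramE.
have gram_tr : forall i, (gram B (Wm w) i)^T = gram B (Wm w) i :=
  gram_tr n0 AT pB isoV wV.
have [v [d [pv pd hv ds [h1 h2]]]] :=
  quasi_periodic_data n0 AT pB Bu isoV rkN wV GuW qD.
have su := sgram_unit AT pB Bu isoV rkN wV qD.
have := index_identity n0 AT pB pW gram_tr gram_unit tW pv pd hv h1 h2 ds su.
rewrite -Xperp_perp -hperpE.
rewrite -(ind_bform AT pB Bu isoV rkN wV qD) -/N => idE.
have sE : sigma n B = sigma_perp n B e
    * \prod_(1 <= i < n.+1) Num.sg (\det (gram B (Wm w) i%:Z)).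
  (* k <= m, because G_0 has rank k and factors through W_0 : 'M_(k, m). *)
  have km : (m - k + k)%N = m.
    apply: subnK; have := mxrank_unit (gram_unit 0); rewrite /gram => rk.
    rewrite -{1}rk -mulmxA; exact: leq_trans (mxrankM_maxl _ _) (rank_leq_col _).
  have ef i : row_free (e i) by case: (eP i).
  have pe : nperiodic n e by move=> i; case: (eP i).
  have he : perp B (Wm w) e.
    by move=> i; apply/sub_EperpE; case: (eP i) => _ /eqmxP -> _.
  exact: sigma_split.
rewrite sE -mulrA; congr (_ * _).
rewrite (prod_period0 (F := fun i => Num.sg (\det (gram B (Wm w) i)))) //; last first.
  by move=> i; rewrite (gram_periodic pB pW).
rewrite (eq_bigr (fun i : nat => (-1) ^+ ind setT (pairing (gram B (Wm w) i%:Z))));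
  last by move=> i _; rewrite sg_det_ind.
(* Both exponents have the same parity by idE. *)
rewrite prodrXr -exprD -[LHS]signr_odd -[RHS]signr_odd; congr (_ ^+ nat_of_bool _).
have := congr1 odd idE; rewrite !oddD.
by do 4!case: (odd _).
Qed.
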